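(* Let $\mathbf{k}$ be a field. Let $F : \underline{Hopf\text{-}Alg} \to \underline{Q\star Heaps}$ be the functor from the category of Hopf algebras over $\mathbf{k}$ to the category of copointed quantum heaps over $\mathbf{k}$ which sends a Hopf algebra $(H,\mu,\eta,\Delta,\epsilon)$ with antipode $S$ to the same unital algebra $(H,\mu,\eta)$ equipped with the ternary cooperation $$\tau(h) = \sum h_{(1)} \otimes S h_{(2)} \otimes h_{(3)}$$ and with the same $\epsilon$, and which is the identity on underlying maps of morphisms. Let $\chi : \underline{Q\star Heaps} \to \underline{Hopf\text{-}Alg}$ be the functor which sends a copointed quantum heap $(H,\mu,\eta,\tau,\epsilon)$ to the same unital algebra $(H,\mu,\eta)$ equipped with the comultiplication $$\Delta = (\mathrm{id}\otimes\epsilon\otimes\mathrm{id})\circ\tau : H \to H\otimes\mathbf{k}\otimes H \cong H\otimes H,$$ with counit $\epsilon$, and with antipode $$S = (\epsilon\otimes\mathrm{id}\otimes\epsilon)\circ\tau : H \to \mathbf{k}\otimes H\otimes \mathbf{k}\cong H,$$ and which is the identity on underlying maps of morphisms. Then $F$ and $\chi$ are mutually inverse isomorphisms of categories between $\underline{Hopf\text{-}Alg}$ and $\underline{Q\star Heaps}$.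
   Context: Throughout, $\mathbf{k}$ is a fixed ground field, and $\otimes=\otimes_{\mathbf{k}}$. A quantum heap is an associative unital $\mathbf{k}$-algebra $(H,\mu,\eta)$, with unit element $1_H=\eta(1)$, together with a map $\tau : H \to H\otimes H_{\mathrm{op}}\otimes H$ that is a homomorphism of unital $\mathbf{k}$-algebras (where $H_{\mathrm{op}}$ is the vector space $H$ with the opposite multiplication and the tensor product has the usual algebra structure) such that, as maps of vector spaces, $$(\mathrm{id}\otimes\mathrm{id}\otimes\tau)\circ\tau = (\tau\otimes\mathrm{id}\otimes\mathrm{id})\circ\tau,\qquad (\mathrm{id}\otimes\mu)(\tau(h)) = h\otimes 1_H,\qquad (\mu\otimes\mathrm{id})(\tau(h)) = 1_H\otimes h \quad\text{for all } h\in H.$$ A morphism of quantum heaps $\phi : H\to H'$ is a homomorphism of unital $\mathbf{k}$-algebras such that $\tau'\circ\phi = (\phi\otimes\phi\otimes\phi)\circ\tau$. A copointed quantum heap is a pair $(\mathbf{A},\epsilon)$ consisting of a quantum heap $\mathbf{A}=(A,\mu,\eta,\tau)$ and a unital $\mathbf{k}$-algebra homomorphism $\epsilon : A\to\mathbf{k}$. A morphism of copointed quantum heaps $(\mathbf{A},\epsilon)\to(\mathbf{A}',\epsilon')$ is a morphism of quantum heaps $\phi:\mathbf{A}\to\mathbf{A}'$ with $\epsilon'\circ\phi=\epsilon$. The resulting category is denoted $\underline{Q\star Heaps}$. The category $\underline{Hopf\text{-}Alg}$ has Hopf algebras over $\mathbf{k}$ as objects and homomorphisms of Hopf algebras as morphisms.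 For a Hopf algebra, $\sum h_{(1)}\otimes h_{(2)}\otimes h_{(3)} = (\mathrm{id}\otimes\Delta)\Delta(h)$ is the usual Sweedler notation (lower indices). *)

(* Defs.v *)
From HB Require Import structures.
From mathcomp Require Import all_boot all_order all_algebra.
From mathcomp Require Import boolp classical_sets.

Set Implicit Arguments.
Unset Strict Implicit.
Unset Printing Implicit Defensive.

Import GRing.Theory.
Local Open Scope ring_scope.
Local Open Scope quotient_scope.

(** * Tensor products

    [V ⊗ W] is the set of formal sums of pairs [(v, w)], encoded as lists,
    modulo the additive congruence generated by the bilinearity relations.
    No formal coefficients are needed, as a scalar can be moved into [v]. *)

Section Tensor.
Variables (K : fieldType) (V W : lmodType K).

Inductive teq : seq (V * W) -> seq (V * W) -> Prop :=
| teq_refl s : teq s s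
| teq_sym s t : teq s t -> teq t s
| teq_trans s t u : teq s t -> teq t u -> teq s u
| teq_cat s s' t t' : teq s s' -> teq t t' -> teq (s ++ t) (s' ++ t')
| teq_catC s t : teq (s ++ t) (t ++ s)
| teq_zero w : teq [:: (0, w)] [::]
| teq_addl v v' w : teq [:: (v + v', w)] [:: (v, w); (v', w)]
| teq_addr v w w' : teq [:: (v, w + w')] [:: (v, w); (v, w')]
| teq_scale a v w : teq [:: (a *: v, w)] [:: (v, a *: w)].

Definition teqb (s t : seq (V * W)) : bool := `[< teq s t >].

Fact teqb_equiv : equiv_class_of teqb.
Proof.
split=> [s | s t | s t u].
- by apply/asboolP; exact: teq_refl.
- by apply/asboolP/asboolP; exact: teq_sym.
- by move=> /asboolP st /asboolP tu; apply/asboolP; exact: teq_trans st tu.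
Qed.

Canonical teqb_equiv_rel := EquivRelPack teqb_equiv.

Definition tensor : Type := {eq_quot teqb_equiv_rel}.

HB.instance Definition _ := Choice.on tensor.
HB.instance Definition _ := EqQuotient.on tensor.

Definition tcls (s : seq (V * W)) : tensor := \pi_({eq_quot teqb_equiv_rel}) s.

Lemma tclsP s t : teq s t -> tcls s = tcls t.
Proof. by move=> st; apply/(@eqmodP _ teqb_equiv_rel)/asboolP. Qed.

Lemma tcls_repr x : tcls (repr x) = x.
Proof. exact: reprK. Qed.

Lemma teq_repr s : teq (repr (tcls s)) s.
Proof. by apply/asboolP/(@eqmodP _ teqb_equiv_rel); exact: reprK. Qed.

Definition pure (v : V) (w : W) : tensor := tcls [:: (v, w)].
Definition tzero : tensor := tcls [::].
Definition tadd (x y : tensor) : tensor := tcls (repr x ++ repr y).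
Definition tscale (a : K) (x : tensor) : tensor :=
  tcls [seq (a *: p.1, p.2) | p <- repr x].
Definition topp (x : tensor) : tensor := tscale (-1) x.

Lemma tadd_cls s t : tadd (tcls s) (tcls t) = tcls (s ++ t).
Proof. by apply: tclsP; apply: teq_cat; exact: teq_repr. Qed.

Lemma teq_map_scale a s t : teq s t ->
  teq [seq (a *: p.1, p.2) | p <- s] [seq (a *: p.1, p.2) | p <- t].
Proof.
elim=> {s t} /=.
- by move=> s; exact: teq_refl.
- by move=> s t _; exact: teq_sym.
- by move=> s t u _ st _; exact: teq_trans.
- by move=> s s' t t' _ ss _ tt; rewrite !map_cat; exact: teq_cat.
- by move=> s t; rewrite !map_cat; exact: teq_catC.
- by move=> w; rewrite scaler0; exact: teq_zero.
- by move=> v v' w; rewrite scalerDr; exact: teq_addl.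
- by move=> v w w'; exact: teq_addr.
- by move=> b v w; rewrite scalerA mulrC -scalerA; exact: teq_scale.
Qed.

Lemma tscale_cls a s : tscale a (tcls s) = tcls [seq (a *: p.1, p.2) | p <- s].
Proof. by apply: tclsP; apply: teq_map_scale; exact: teq_repr. Qed.

Lemma tcls_ind (P : tensor -> Prop) : (forall s, P (tcls s)) -> forall x, P x.
Proof. by move=> H x; rewrite -[x]tcls_repr. Qed.

Fact taddA : associative tadd.
Proof.
elim/tcls_ind=> s; elim/tcls_ind=> t; elim/tcls_ind=> u.
by rewrite !tadd_cls catA.
Qed.

Fact taddC : commutative tadd.
Proof.
elim/tcls_ind=> s; elim/tcls_ind=> t.
by rewrite !tadd_cls; apply: tclsP; exact: teq_catC.
Qed.

Fact tadd0 : left_id tzero tadd.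
Proof. by elim/tcls_ind=> s; rewrite tadd_cls. Qed.

Lemma tcls_cons p s : tcls (p :: s) = tadd (tcls [:: p]) (tcls s).
Proof. by rewrite tadd_cls. Qed.

Fact tscaleDl x (a b : K) : tscale (a + b) x = tadd (tscale a x) (tscale b x).
Proof.
elim/tcls_ind: x => s; rewrite !tscale_cls.
elim: s => [|[v w] s IHs]; first by rewrite tadd_cls.
rewrite /= (tcls_cons ((a + b) *: v, w)) (tcls_cons (a *: v, w)).
rewrite (tcls_cons (b *: v, w)) IHs scalerDl.
have -> : tcls [:: (a *: v + b *: v, w)] =
   tadd (tcls [:: (a *: v, w)]) (tcls [:: (b *: v, w)]).
  by rewrite tadd_cls; apply: tclsP; exact: teq_addl.
rewrite -!taddA; congr tadd.
by rewrite !taddA; congr tadd; rewrite taddC.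
Qed.

Fact tscale0 x : tscale 0 x = tzero.
Proof.
elim/tcls_ind: x => s; rewrite tscale_cls.
elim: s => [|[v w] s IHs] //=; rewrite tcls_cons IHs scale0r.
have -> : tcls [:: (0, w)] = tzero by apply: tclsP; exact: teq_zero.
by rewrite tadd0.
Qed.

Fact tscale1 : left_id 1 tscale.
Proof.
elim/tcls_ind=> s; rewrite tscale_cls; congr tcls.
by rewrite -[RHS]map_id; apply: eq_map => -[v w] /=; rewrite scale1r.
Qed.

Fact taddN : left_inverse tzero topp tadd.
Proof.
by move=> x; rewrite /topp -{2}[x]tscale1 -tscaleDl addNr tscale0.
Qed.

HB.instance Definition _ := GRing.isZmodule.Build tensor taddA taddC tadd0 taddN.

Fact tscaleA a b x : tscale a (tscale b x) = tscale (a * b) x.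
Proof.
elim/tcls_ind: x => s; rewrite !tscale_cls -map_comp; congr tcls.
by apply: eq_map => -[v w] /=; rewrite scalerA.
Qed.

Fact tscaleDr : right_distributive tscale +%R.
Proof.
move=> a; elim/tcls_ind=> s; elim/tcls_ind=> t.
by rewrite -[_ + _]/(tadd _ _) tadd_cls !tscale_cls map_cat -tadd_cls.
Qed.

HB.instance Definition _ :=
  GRing.Zmodule_isLmodule.Build K tensor tscaleA tscale1 tscaleDr
    (fun x a b => tscaleDl x a b).

End Tensor.

Notation "V ⊗ W" := (tensor V W) (at level 40, left associativity) : type_scope.

(** [tlift f] is the linear map on [V ⊗ W] induced by [f]; it is meaningful
    only when [f] is bilinear, see [tlift_pure] and [tlift_linear]. *)
Definition tlift (K : fieldType) (V W U : lmodType K) (f : V -> W -> U)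
  (x : V ⊗ W) : U := \sum_(p <- repr x) f p.1 p.2.

Lemma linD (K : fieldType) (U U' : lmodType K) (f : U -> U') : linear f -> {morph f : x y / x + y}.
Proof. by move=> lf x y; have := lf 1 x y; rewrite !scale1r. Qed.

Lemma lin0 (K : fieldType) (U U' : lmodType K) (f : U -> U') : linear f -> f 0 = 0.
Proof.
by move=> lf; have := lf (-1) 0 0; rewrite scaler0 addr0 scaleN1r addNr.
Qed.

Lemma linZ (K : fieldType) (U U' : lmodType K) (f : U -> U') : linear f -> forall a, {morph f : x / a *: x}.
Proof. by move=> lf a x; have := lf a x 0; rewrite (lin0 lf) !addr0. Qed.

Section Lift.
Variables (K : fieldType) (V W : lmodType K).
Implicit Type U : lmodType K.

Definition bilin U (f : V -> W -> U) : Prop := bilinear_for *:%R *:%R f.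

Lemma pure_bilin : bilin (@pure K V W).
Proof.
have pDl (v v' : V) (w : W) : pure (v + v') w = pure v w + pure v' w.
  rewrite -[_ + _ in RHS]/(tadd _ _) tadd_cls; apply: tclsP; exact: teq_addl.
have pDr (v : V) (w w' : W) : pure v (w + w') = pure v w + pure v w'.
  rewrite -[_ + _ in RHS]/(tadd _ _) tadd_cls; apply: tclsP; exact: teq_addr.
have pZl a (v : V) (w : W) : pure (a *: v) w = a *: pure v w.
  by rewrite -[_ *: _ in RHS]/(tscale _ _) tscale_cls.
have pZr a (v : V) (w : W) : pure v (a *: w) = a *: pure v w.
  by rewrite -pZl; apply/esym/tclsP; exact: teq_scale.
by split=> [w a v v' | v a w w']; rewrite ?pDl ?pDr ?pZl ?pZr.
Qed.

Lemma pure_linl w : linear (fun v => @pure K V W v w).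
Proof. exact: pure_bilin.1. Qed.

Lemma pure_linr v : linear (@pure K V W v).
Proof. exact: pure_bilin.2. Qed.

Lemma tcls_sum (s : seq (V * W)) : tcls s = \sum_(p <- s) pure p.1 p.2.
Proof.
elim: s => [|[v w] s IHs]; first by rewrite big_nil.
by rewrite big_cons -IHs -[_ + _]/(tadd _ _) tadd_cls.
Qed.

Lemma tensor_ind (P : V ⊗ W -> Prop) :
  P 0 -> (forall x y, P x -> P y -> P (x + y)) -> (forall v w, P (pure v w)) ->
  forall x, P x.
Proof.
move=> P0 PD Pp x; rewrite -[x]tcls_repr tcls_sum.
by apply: big_ind => // p _; exact: Pp.
Qed.

Lemma tlift_cls U (f : V -> W -> U) (s : seq (V * W)) : bilin f ->
  tlift f (tcls s) = \sum_(p <- s) f p.1 p.2.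
Proof.
case=> fl fr; rewrite /tlift.
suff tE t u : teq t u -> \sum_(p <- t) f p.1 p.2 = \sum_(p <- u) f p.1 p.2.
  by apply: tE; exact: teq_repr.
elim=> {s t u} //=.
- by move=> s t u _ IHs _ IHt; rewrite IHs.
- by move=> s s' t t' _ e _ e'; rewrite !big_cat /= e e'.
- by move=> s t; rewrite !big_cat /= addrC.
- by move=> w; rewrite big_cons !big_nil addr0 /= (lin0 (fl w)).
- by move=> v v' w; rewrite !big_cons !big_nil !addr0 /= (linD (fl w)).
- by move=> v w w'; rewrite !big_cons !big_nil !addr0 /= (linD (fr v)).
- by move=> a v w; rewrite !big_cons !big_nil !addr0 /= (linZ (fl w)) (linZ (fr v)).
Qed.

Lemma tlift_pure U (f : V -> W -> U) v w : bilin f -> tlift f (pure v w) = f v w.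
Proof. by move=> fb; rewrite tlift_cls // big_seq1. Qed.

Lemma tlift_linear U (f : V -> W -> U) : bilin f -> linear (tlift f).
Proof.
move=> fb a; elim/tcls_ind=> s; elim/tcls_ind=> t.
rewrite -[_ + _ in LHS]/(tadd (tscale _ _) _) tscale_cls tadd_cls.
rewrite !tlift_cls // big_cat /= big_map scaler_sumr; congr (_ + _).
by apply: eq_bigr => -[v w] _; rewrite /= (linZ (fb.1 w)).
Qed.

Lemma tensor_ext U (f g : V ⊗ W -> U) : linear f -> linear g ->
  (forall v w, f (pure v w) = g (pure v w)) -> f =1 g.
Proof.
move=> lf lg fg; elim/tensor_ind=> [|x y fx fy|v w] //.
- by rewrite !lin0.
- by rewrite (linD lf) (linD lg) fx fy.
Qed.

End Lift.

Lemma tlift_comb (K : fieldType) (V W U : lmodType K) (f g h : V -> W -> U) (c : K)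
    (t : V ⊗ W) :
  (forall v w, f v w = c *: g v w + h v w) ->
  tlift f t = c *: tlift g t + tlift h t.
Proof.
move=> fgh; rewrite /tlift scaler_sumr -big_split /=.
by apply: eq_bigr => p _; exact: fgh.
Qed.

Section Functional.
Local Open Scope classical_set_scope.

Lemma exists_functional (K : fieldType) (V : lmodType K) (v : V) : v != 0 ->
  exists2 phi : V -> K^o, linear phi & phi v = 1.
Proof.
move=> v0.
pose P (A : set V) :=
  (forall a x y, A x -> A y -> A (a *: x + y)) /\ ~ A v.
have [F FP Ftot|A [[Acl Av] Amax]] := @Zorn_bigcup V P.
  split=> [a x y [X FX Xx] [Y FY Yy]|[X FX Xv]]; last by case: (FP X FX) => _; apply.
  have [XY|YX] := Ftot X Y FX FY.
    by exists Y => //; have [h _] := FP Y FY; apply: h => //; apply: XY.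
  by exists X => //; have [h _] := FP X FX; apply: h => //; apply: YX.
have A0 : A 0.
  apply: contrapT => nA0; apply: (Amax [set 0]).
    split=> [|sub]; last by apply: nA0; apply: sub.
    by move=> x Ax; case: nA0; rewrite -(addNr x) -scaleN1r; apply: Acl.
  split=> [a x y -> ->|/eqP]; first by rewrite scaler0 addr0.
  by rewrite (negPf v0).
have AZ a x : A x -> A (a *: x) by move=> Ax; rewrite -[_ *: _]addr0; apply: Acl.
have AD x y : A x -> A y -> A (x + y).
  by move=> Ax Ay; rewrite -[x]scale1r; apply: Acl.
have ex x : exists c : K, A (x - c *: v).
  apply: contrapT => nex.
  have nAx : ~ A x by move=> Ax; apply: nex; exists 0; rewrite scale0r subr0.
  apply: (Amax [set z | exists d : K, A (z - d *: x)]).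
    split=> [y Ay|sub]; first by exists 0; rewrite scale0r subr0.
    by apply: nAx; apply: sub; exists 1; rewrite scale1r subrr.
  split=> [a y z [d Ad] [e Ae]|[d Ad]].
    exists (a * d + e).
    rewrite scalerDl opprD -scalerA addrACA -scalerBr.
    exact: Acl.
  have d0 : d != 0 by apply: contraPneq Ad => ->; rewrite scale0r subr0.
  apply: nex; exists d^-1; have := AZ (- d^-1) _ Ad.
  by rewrite scalerBr scalerA mulNr mulVf // !scaleNr scale1r opprK addrC.
have uniq_c x c c' : A (x - c *: v) -> A (x - c' *: v) -> c = c'.
  move=> Ac Ac'; apply/eqP; rewrite -subr_eq0; apply: contra_notT Av => cc'.
  have : A ((c - c') *: v).
    have -> : (c - c') *: v = (-1) *: (x - c *: v) + (x - c' *: v).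
      by rewrite scaleN1r opprB scalerBl addrA subrK.
    exact: Acl.
  by move/(AZ (c - c')^-1); rewrite scalerA mulVf // scale1r.
pose phi x : K^o := sval (cid (ex x)).
have phiP x : A (x - phi x *: v) := svalP (cid (ex x)).
exists phi.
  move=> a x y; apply: (uniq_c (a *: x + y)) => //.
  by rewrite scalerDl opprD -scalerA addrACA -scalerBr; apply: Acl.
by apply: (uniq_c v) => //; rewrite scale1r subrr.
Qed.

End Functional.

Section Maps.
Variable K : fieldType.
Implicit Types U V W : lmodType K.

Definition tmap V V' W W' (f : V -> V') (g : W -> W') : V ⊗ W -> V' ⊗ W' :=
  tlift (fun v w => pure (f v) (g w)).

Definition tassoc U V W : (U ⊗ V) ⊗ W -> U ⊗ (V ⊗ W) :=
  tlift (fun x w => tlift (fun u v => pure u (pure v w)) x).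

Definition tassocV U V W : U ⊗ (V ⊗ W) -> (U ⊗ V) ⊗ W :=
  tlift (fun u y => tlift (fun v w => pure (pure u v) w) y).

Definition tunitl V : K^o ⊗ V -> V := tlift (fun (a : K^o) v => (a : K) *: v).
Definition tunitr V : V ⊗ K^o -> V := tlift (fun v (a : K^o) => (a : K) *: v).

Lemma tassoc_pure U V W (u : U) (v : V) (w : W) :
  tassoc (pure (pure u v) w) = pure u (pure v w).
Proof.
have b (w' : W) : bilin (fun (u : U) (v : V) => pure u (pure v w')).
  split=> [v' | u' a x y] /=; first exact: pure_linl.
  by rewrite pure_linl pure_linr.
rewrite /tassoc tlift_pure; last first.
  split=> [w' | x a y z] /=; first exact: (tlift_linear (b w')).
  by apply: tlift_comb => u' v'; rewrite !pure_linr.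
exact: (tlift_pure _ _ (b w)).
Qed.

Lemma tassocV_pure U V W (u : U) (v : V) (w : W) :
  tassocV (pure u (pure v w)) = pure (pure u v) w.
Proof.
have b (u' : U) : bilin (fun (v : V) (w : W) => pure (pure u' v) w).
  split=> [w' a x y | v'] /=; last exact: pure_linr.
  by rewrite pure_linr pure_linl.
rewrite /tassocV tlift_pure; last first.
  split=> [x a y z | u'] /=; last exact: (tlift_linear (b u')).
  by apply: tlift_comb => v' w'; rewrite !pure_linl.
exact: (tlift_pure _ _ (b u)).
Qed.

Lemma tunitl_pure V (a : K^o) (v : V) : tunitl (pure a v) = (a : K) *: v.
Proof.
apply: tlift_pure; split=> [w b x y | b c x y] /=.
  by rewrite scalerDl -scalerA.
by rewrite scalerDr !scalerA mulrC.
Qed.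

Lemma tunitr_pure V (v : V) (a : K^o) : tunitr (pure v a) = (a : K) *: v.
Proof.
apply: tlift_pure; split=> [b c x y | w b x y] /=.
  by rewrite scalerDr !scalerA mulrC.
by rewrite scalerDl -scalerA.
Qed.

End Maps.

(** * Tensor products of algebras *)

Section TensorAlgebra.
Variables (K : fieldType) (A B : algType K).
Implicit Types (a : A) (b : B) (x y z : A ⊗ B).

Definition tmul x y : A ⊗ B :=
  tlift (fun a b => tlift (fun a' b' => pure (a * a') (b * b')) y) x.
Definition tone : A ⊗ B := pure 1 1.

Lemma tmul_bilin_in a b : bilin (fun a' b' => pure (a * a') (b * b')).
Proof.
split=> [b' c u v | a' c u v] /=; rewrite mulrDr -scalerAr.
  exact: pure_linl.
exact: pure_linr.
Qed.

Lemma tmul_bilin_out y :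
  bilin (fun a b => tlift (fun a' b' => pure (a * a') (b * b')) y).
Proof.
split=> [b c u v | a c u v] /=; apply: tlift_comb => a' b';
  rewrite mulrDl -scalerAl.
  exact: pure_linl.
exact: pure_linr.
Qed.

Lemma tmul_pure a b a' b' :
  tmul (pure a b) (pure a' b') = pure (a * a') (b * b').
Proof.
rewrite /tmul tlift_pure; last exact: tmul_bilin_out.
by rewrite tlift_pure //; exact: tmul_bilin_in.
Qed.

Lemma tmul_linl y : linear (tmul^~ y).
Proof. exact: tlift_linear (tmul_bilin_out y). Qed.

Lemma tmul_linr x : linear (tmul x).
Proof.
move=> c y z; apply: tlift_comb => a b.
exact: tlift_linear (tmul_bilin_in a b) c y z.
Qed.

Fact tmulDl : left_distributive tmul +%R.
Proof. by move=> x y z; exact: (linD (tmul_linl z)). Qed.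

Fact tmulDr : right_distributive tmul +%R.
Proof. by move=> x y z; exact: (linD (tmul_linr x)). Qed.

Fact tmulA : associative tmul.
Proof.
move=> x y z; elim/tensor_ind: x => [|x x' Hx Hx'|a b].
- by rewrite !(lin0 (tmul_linl _)).
- by rewrite !tmulDl Hx Hx'.
elim/tensor_ind: y => [|y y' Hy Hy'|a' b'].
- by rewrite (lin0 (tmul_linl _)) !(lin0 (tmul_linr _)) (lin0 (tmul_linl _)).
- by rewrite !(tmulDl, tmulDr) Hy Hy'.
elim/tensor_ind: z => [|z z' Hz Hz'|a'' b''].
- by rewrite !(lin0 (tmul_linr _)).
- by rewrite !tmulDr Hz Hz'.
- by rewrite !tmul_pure !mulrA.
Qed.

Fact tmul1 : left_id tone tmul.
Proof.
elim/tensor_ind=> [|x y Hx Hy|a b]; first by rewrite (lin0 (tmul_linr _)).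
- by rewrite tmulDr Hx Hy.
- by rewrite tmul_pure !mul1r.
Qed.

Fact tmulr1 : right_id tone tmul.
Proof.
elim/tensor_ind=> [|x y Hx Hy|a b]; first by rewrite (lin0 (tmul_linl _)).
- by rewrite tmulDl Hx Hy.
- by rewrite tmul_pure !mulr1.
Qed.

Fact tone_neq0 : tone != 0.
Proof.
have [f fl f1] := exists_functional (oner_neq0 A).
have [g gl g1] := exists_functional (oner_neq0 B).
have fgb : bilin (fun a b => f a * g b : K^o).
  split=> [b c u v | a c u v] /=; first by rewrite fl mulrDl scalerAl.
  by rewrite gl mulrDr scalerAr.
apply/eqP => /(congr1 (tlift (fun a b => f a * g b : K^o))).
rewrite tlift_pure // (lin0 (tlift_linear fgb)) f1 g1 mulr1.
by apply/eqP; exact: oner_neq0.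
Qed.

HB.instance Definition _ := GRing.Zmodule_isNzRing.Build (A ⊗ B)
  tmulA tmul1 tmulr1 tmulDl tmulDr tone_neq0.

Fact tscaleAl (c : K) x y : c *: (x * y) = (c *: x) * y.
Proof. exact/esym/(linZ (tmul_linl y)). Qed.

HB.instance Definition _ := GRing.Lmodule_isLalgebra.Build K (A ⊗ B) tscaleAl.

Fact tscaleAr (c : K) x y : c *: (x * y) = x * (c *: y).
Proof. exact/esym/(linZ (tmul_linr x)). Qed.

HB.instance Definition _ := GRing.Lalgebra_isAlgebra.Build K (A ⊗ B) tscaleAr.

End TensorAlgebra.

(** The library's converse ring [A^c] is the opposite ring on the type [A];
    it gets the vector space structure of [A]. *)
Section OppositeAlgebra.
Variables (K : fieldType) (A : algType K).

HB.instance Definition _ := GRing.Lmodule.on A^c.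

Fact opp_scaleAl (c : K) (x y : A^c) : c *: (x * y) = (c *: x : A^c) * y.
Proof.
exact: (@scalerAr K A c y x).
Qed.

HB.instance Definition _ := GRing.Lmodule_isLalgebra.Build K A^c opp_scaleAl.

Fact opp_scaleAr (c : K) (x y : A^c) : c *: (x * y) = x * (c *: y : A^c).
Proof.
exact: (@scalerAl K A c y x).
Qed.

HB.instance Definition _ := GRing.Lalgebra_isAlgebra.Build K A^c opp_scaleAr.

End OppositeAlgebra.

(** Since [A^c] and [A] are convertible, unification could select either ring
    structure on this type; the algebra structures are therefore given by name
    wherever a map is required to be an algebra homomorphism. *)
Definition opp_alg (K : fieldType) (A : algType K) : algType K := A^c.
Definition tensor_alg (K : fieldType) (A B : algType K) : algType K := A ⊗ B.

Definition alg_hom (K : fieldType) (A B : algType K) (f : A -> B) : Prop :=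
  linear f /\ GRing.monoid_morphism f.

Definition heap_alg (K : fieldType) (A : algType K) : algType K :=
  tensor_alg A (tensor_alg (opp_alg A) A).

Lemma heap_alg_mul (K : fieldType) (A : algType K) (x y z x' y' z' : A) :
  (pure x (pure (y : A^c) z) : heap_alg A) * pure x' (pure (y' : A^c) z') =
  pure (x * x') (pure (y' * y : A) (z * z')).
Proof.
rewrite [LHS](@tmul_pure K A (tensor_alg (opp_alg A) A)); congr pure.
exact: (@tmul_pure K (opp_alg A) A).
Qed.

(** When a factor of the tensor product is [A^c], the product is still taken
    in [A]: the axioms relating [tau] to the multiplication see the opposite
    algebra only as a vector space. *)
Section Multiplication.
Variables (K : fieldType) (A : algType K).

Definition mu : A ⊗ A -> A := tlift (fun x y : A => @GRing.mul A x y).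
Definition mu_copp : A ⊗ A^c -> A :=
  tlift (fun (x : A) (y : A^c) => @GRing.mul A x y).
Definition mu_opp : A^c ⊗ A -> A :=
  tlift (fun (x : A^c) (y : A) => @GRing.mul A x y).

End Multiplication.

(** * Copointed quantum heaps and Hopf algebras *)

(** An [algType] is a nonzero algebra; this excludes nothing here, as an algebra
    with a unital homomorphism to the ground field is nonzero. The ground field
    as an algebra over itself is [K^o]. *)
Record heap_data (K : fieldType) := HeapData {
  heap_car :> algType K;
  tau : heap_car -> heap_car ⊗ (heap_car^c ⊗ heap_car);
  copoint : heap_car -> K^o
}.

Record is_quantum_heap (K : fieldType) (A : algType K)
    (t : A -> A ⊗ (A^c ⊗ A)) : Prop := IsQuantumHeap {
  tau_alg : @alg_hom K A (heap_alg A) t;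
  tau_assoc : forall h,
    tmap (@id A) (tmap (@id A^c) t) (t h) =
    tmap (@id A) (@tassoc K A^c A (A^c ⊗ A))
      (@tassoc K A (A^c ⊗ A) (A^c ⊗ A) (tmap t (@id (A^c ⊗ A)) (t h)));
  tau_mur : forall h, tmap (@id A) (@mu_opp K A) (t h) = pure h (1 : A);
  tau_mul : forall h,
    tmap (@mu_copp K A) (@id A) (@tassocV K A A^c A (t h)) = pure (1 : A) h
}.

Definition is_copointed_heap (K : fieldType) (H : heap_data K) : Prop :=
  is_quantum_heap (@tau K H) /\ @alg_hom K H K^o (@copoint K H).

Record is_heap_hom (K : fieldType) (H H' : heap_data K) (f : H -> H') : Prop :=
  IsHeapHom {
  heap_hom_alg : alg_hom f;
  heap_hom_tau : forall h,
    tau (f h) = tmap f (tmap (f : H^c -> H'^c) f) (tau h);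
  heap_hom_copoint : forall h, copoint (f h) = copoint h
}.

Record hopf_data (K : fieldType) := HopfData {
  hopf_car :> algType K;
  comul : hopf_car -> hopf_car ⊗ hopf_car;
  counit : hopf_car -> K^o;
  antipode : hopf_car -> hopf_car
}.

Record is_hopf (K : fieldType) (H : hopf_data K) : Prop := IsHopf {
  comul_alg : @alg_hom K H (tensor_alg H H) (@comul K H);
  counit_alg : @alg_hom K H K^o (@counit K H);
  antipode_linear : linear (@antipode K H);
  comul_coassoc : forall h : H,
    tmap (@id H) (@comul K H) (comul h) =
    @tassoc K H H H (tmap (@comul K H) (@id H) (comul h));
  counit_l : forall h : H, tunitl (tmap (@counit K H) (@id H) (comul h)) = h;
  counit_r : forall h : H, tunitr (tmap (@id H) (@counit K H) (comul h)) = h;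
  antipode_l : forall h : H,
    mu (tmap (@antipode K H) (@id H) (comul h)) = (counit h : K)%:A;
  antipode_r : forall h : H,
    mu (tmap (@id H) (@antipode K H) (comul h)) = (counit h : K)%:A
}.

Record is_hopf_hom (K : fieldType) (H H' : hopf_data K) (f : H -> H') : Prop :=
  IsHopfHom {
  hopf_hom_alg : alg_hom f;
  hopf_hom_comul : forall h, comul (f h) = tmap f f (comul h);
  hopf_hom_counit : forall h, counit (f h) = counit h;
  hopf_hom_antipode : forall h, antipode (f h) = f (antipode h)
}.

(** * Categories *)

Record category := Category {
  obj :> Type;
  mor : obj -> obj -> Type;
  idm : forall X, mor X X;
  compm : forall X Y Z, mor Y Z -> mor X Y -> mor X Z;
  compm1l : forall X Y (f : mor X Y), compm (idm Y) f = f;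
  compm1r : forall X Y (f : mor X Y), compm f (idm X) = f;
  compmA : forall W X Y Z (f : mor Y Z) (g : mor X Y) (h : mor W X),
    compm f (compm g h) = compm (compm f g) h
}.

Record functor (C D : category) := Functor {
  fob :> C -> D;
  fmor : forall X Y : C, mor X Y -> mor (fob X) (fob Y);
  fmor_id : forall X : C, fmor (idm X) = idm (fob X);
  fmor_comp : forall (X Y Z : C) (f : mor Y Z) (g : mor X Y),
    fmor (compm f g) = compm (fmor f) (fmor g)
}.

Program Definition fid (C : category) : functor C C :=
  {| fob X := X; fmor X Y f := f |}.

Program Definition fcomp (C D E : category) (G : functor D E) (F : functor C D) :
  functor C E := {| fob X := G (F X); fmor X Y f := fmor G (fmor F f) |}.
Next Obligation. by rewrite !fmor_id. Qed.
Next Obligation. by rewrite !fmor_comp. Qed.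

(** Equality of functors is the strict one, on objects and on morphisms. *)
Definition mutually_inverse (C D : category) (F : functor C D) (G : functor D C)
  : Prop := fcomp G F = fid C /\ fcomp F G = fid D.

Section MapLemmas.
Variable K : fieldType.
Implicit Types U V W : lmodType K.

Lemma tmap_bilin V V' W W' (f : V -> V') (g : W -> W') :
  linear f -> linear g -> bilin (fun v w => pure (f v) (g w)).
Proof.
move=> lf lg; split=> [w a u v | v a u w] /=; rewrite ?lf ?lg.
  exact: pure_linl.
exact: pure_linr.
Qed.

Lemma tmap_linear V V' W W' (f : V -> V') (g : W -> W') :
  linear f -> linear g -> linear (tmap f g).
Proof. by move=> lf lg; apply/tlift_linear/tmap_bilin. Qed.

Lemma tmap_pure V V' W W' (f : V -> V') (g : W -> W') v w :
  linear f -> linear g -> tmap f g (pure v w) = pure (f v) (g w).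
Proof. by move=> lf lg; apply/tlift_pure/tmap_bilin. Qed.

Lemma id_linear V : linear (@id V). Proof. by []. Qed.

Lemma comp_linear U V W (f : V -> W) (g : U -> V) :
  linear f -> linear g -> linear (f \o g).
Proof. by move=> lf lg a x y; rewrite /= lg lf. Qed.

Lemma tmap_id V W : tmap (@id V) (@id W) =1 id.
Proof.
apply: tensor_ext => [|//|v w]; first exact/tmap_linear.
by rewrite tmap_pure.
Qed.

Lemma tmap_comp V V' V'' W W' W'' (f : V' -> V'') (f' : V -> V')
    (g : W' -> W'') (g' : W -> W') :
  linear f -> linear f' -> linear g -> linear g' ->
  tmap (f \o f') (g \o g') =1 tmap f g \o tmap f' g'.
Proof.
move=> lf lf' lg lg'; apply: tensor_ext => [||v w].
- by apply: tmap_linear; exact: comp_linear.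
- by apply: comp_linear; exact: tmap_linear.
- by rewrite /= !tmap_pure //; exact: comp_linear.
Qed.

End MapLemmas.

Lemma alg_hom_id (K : fieldType) (A : algType K) : alg_hom (@id A).
Proof. by []. Qed.

Lemma alg_hom_comp (K : fieldType) (A B C : algType K) (f : B -> C) (g : A -> B) :
  alg_hom f -> alg_hom g -> alg_hom (f \o g).
Proof.
move=> [lf [f1 fM]] [lg [g1 gM]]; split; first exact: comp_linear.
by split=> [|x y] /=; rewrite ?g1 ?f1 ?gM ?fM.
Qed.

Section HopfCategory.
Variable K : fieldType.

Record hopf_alg := HopfAlg { hopf_of :> hopf_data K; hopfP : is_hopf hopf_of }.

Definition hopf_hom (H H' : hopf_alg) : Type :=
  {f : H -> H' | is_hopf_hom f}.

Lemma hopf_hom_ext (H H' : hopf_alg) (f g : hopf_hom H H') :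
  sval f =1 sval g -> f = g.
Proof. by case: f g => [f p] [g q] fg; apply: eq_exist; exact/funext. Qed.

Lemma is_hopf_hom_id (H : hopf_alg) : is_hopf_hom (@id H).
Proof. by split=> // h; rewrite tmap_id. Qed.

Lemma is_hopf_hom_comp (H H' H'' : hopf_alg) (f : hopf_hom H' H'')
  (g : hopf_hom H H') : is_hopf_hom (sval f \o sval g).
Proof.
case: f g => [f [[lf mf] fD fe fS]] [g [[lg mg] gD ge gS]]; split => /=.
- exact: (alg_hom_comp (conj lf mf) (conj lg mg)).
- by move=> h; rewrite fD gD [RHS]tmap_comp.
- by move=> h; rewrite fe ge.
- by move=> h; rewrite fS gS.
Qed.

Definition hopf_idm (H : hopf_alg) : hopf_hom H H :=
  exist _ id (is_hopf_hom_id H).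

Definition hopf_compm (H H' H'' : hopf_alg) (f : hopf_hom H' H'')
    (g : hopf_hom H H') : hopf_hom H H'' :=
  exist _ (sval f \o sval g) (is_hopf_hom_comp f g).

Fact hopf_compm1l H H' (f : hopf_hom H H') : hopf_compm (hopf_idm H') f = f.
Proof. exact: hopf_hom_ext. Qed.

Fact hopf_compm1r H H' (f : hopf_hom H H') : hopf_compm f (hopf_idm H) = f.
Proof. exact: hopf_hom_ext. Qed.

Fact hopf_compmA H0 H1 H2 H3 (f : hopf_hom H2 H3) (g : hopf_hom H1 H2)
    (h : hopf_hom H0 H1) :
  hopf_compm f (hopf_compm g h) = hopf_compm (hopf_compm f g) h.
Proof. exact: hopf_hom_ext. Qed.

Definition HopfCat : category :=
  Category hopf_compm1l hopf_compm1r hopf_compmA.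

End HopfCategory.

Section HeapCategory.
Variable K : fieldType.

Record copointed_heap :=
  CopointedHeap { heap_of :> heap_data K; heapP : is_copointed_heap heap_of }.

Definition heap_hom (H H' : copointed_heap) : Type :=
  {f : H -> H' | is_heap_hom f}.

Lemma heap_hom_ext (H H' : copointed_heap) (f g : heap_hom H H') :
  sval f =1 sval g -> f = g.
Proof. by case: f g => [f p] [g q] fg; apply: eq_exist; exact/funext. Qed.

Lemma is_heap_hom_id (H : copointed_heap) : is_heap_hom (@id H).
Proof.
split=> // h; have -> : tmap (@id H^c) (@id H) = id by apply/funext/tmap_id.
by rewrite tmap_id.
Qed.

Lemma is_heap_hom_comp (H H' H'' : copointed_heap) (f : heap_hom H' H'')
  (g : heap_hom H H') : is_heap_hom (sval f \o sval g).
Proof.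
case: f g => [f [[lf mf] ft fe]] [g [[lg mg] gt ge]]; split => /=.
- exact: (alg_hom_comp (conj lf mf) (conj lg mg)).
- move=> h; rewrite ft gt.
  pose fc : H'^c -> H''^c := f; pose gc : H^c -> H'^c := g.
  have -> : tmap (fc \o gc) (f \o g) = tmap fc f \o tmap gc g.
    exact/funext/tmap_comp.
  by rewrite [RHS]tmap_comp //; exact: tmap_linear.
- by move=> h; rewrite fe ge.
Qed.

Definition heap_idm (H : copointed_heap) : heap_hom H H :=
  exist _ id (is_heap_hom_id H).

Definition heap_compm (H H' H'' : copointed_heap) (f : heap_hom H' H'')
    (g : heap_hom H H') : heap_hom H H'' :=
  exist _ (sval f \o sval g) (is_heap_hom_comp f g).

Fact heap_compm1l H H' (f : heap_hom H H') : heap_compm (heap_idm H') f = f.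
Proof. exact: heap_hom_ext. Qed.

Fact heap_compm1r H H' (f : heap_hom H H') : heap_compm f (heap_idm H) = f.
Proof. exact: heap_hom_ext. Qed.

Fact heap_compmA H0 H1 H2 H3 (f : heap_hom H2 H3) (g : heap_hom H1 H2)
    (h : heap_hom H0 H1) :
  heap_compm f (heap_compm g h) = heap_compm (heap_compm f g) h.
Proof. exact: heap_hom_ext. Qed.

Definition QHeapCat : category :=
  Category heap_compm1l heap_compm1r heap_compmA.

End HeapCategory.

(** * The functors [F] and [chi] *)

(** [F_data] and [chi_data] give the structure maps of the image of an object.
    That the image is an object, and that a morphism is also a morphism between
    the images, is not proved here: it is the argument [wd] of the functors
    [F] and [chi]. *)
Section Functors.
Variable K : fieldType.

Definition F_data (H : hopf_data K) : heap_data K :=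
  {| heap_car := hopf_car H;
     tau := fun h =>
       tmap (@id H) (tmap (@antipode K H : H -> H^c) (@id H))
         (tmap (@id H) (@comul K H) (comul h));
     copoint := @counit K H |}.

Definition F_well_defined : Prop :=
  (forall H : hopf_data K, is_hopf H -> is_copointed_heap (F_data H)) /\
  (forall (H H' : hopf_data K) (f : H -> H'), is_hopf H -> is_hopf H' ->
    is_hopf_hom f -> @is_heap_hom K (F_data H) (F_data H') f).

Section F.
Variable wd : F_well_defined.

Definition F_ob (H : hopf_alg K) : copointed_heap K :=
  CopointedHeap (wd.1 H (hopfP H)).

Definition F_hom (H H' : hopf_alg K) (f : hopf_hom H H') :
    heap_hom (F_ob H) (F_ob H') :=
  exist _ (sval f) (wd.2 H H' (sval f) (hopfP H) (hopfP H') (svalP f)).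

Fact F_id (H : hopf_alg K) : F_hom (hopf_idm H) = heap_idm (F_ob H).
Proof. exact: heap_hom_ext. Qed.

Fact F_comp (H H' H'' : hopf_alg K) (f : hopf_hom H' H'') (g : hopf_hom H H') :
  F_hom (hopf_compm f g) = heap_compm (F_hom f) (F_hom g).
Proof. exact: heap_hom_ext. Qed.

Definition F : functor (HopfCat K) (QHeapCat K) :=
  @Functor (HopfCat K) (QHeapCat K) F_ob F_hom F_id F_comp.

End F.

Definition chi_data (H : heap_data K) : hopf_data K :=
  {| hopf_car := heap_car H;
     comul := fun h =>
       tmap (@id H)
         (@tunitl K H \o tmap (@copoint K H : H^c -> K^o) (@id H)) (tau h);
     counit := @copoint K H;
     antipode := fun h =>
       tunitl (tmap (@copoint K H)
         (@tunitr K H^c \o tmap (@id H^c) (@copoint K H)) (tau h)) |}.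

Definition chi_well_defined : Prop :=
  (forall H : heap_data K, is_copointed_heap H -> is_hopf (chi_data H)) /\
  (forall (H H' : heap_data K) (f : H -> H'),
    is_copointed_heap H -> is_copointed_heap H' ->
    is_heap_hom f -> @is_hopf_hom K (chi_data H) (chi_data H') f).

Section Chi.
Variable wd : chi_well_defined.

Definition chi_ob (H : copointed_heap K) : hopf_alg K :=
  HopfAlg (wd.1 H (heapP H)).

Definition chi_hom (H H' : copointed_heap K) (f : heap_hom H H') :
    hopf_hom (chi_ob H) (chi_ob H') :=
  exist _ (sval f) (wd.2 H H' (sval f) (heapP H) (heapP H') (svalP f)).

Fact chi_id (H : copointed_heap K) : chi_hom (heap_idm H) = hopf_idm (chi_ob H).
Proof. exact: hopf_hom_ext. Qed.

Fact chi_comp (H H' H'' : copointed_heap K) (f : heap_hom H' H'')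
    (g : heap_hom H H') :
  chi_hom (heap_compm f g) = hopf_compm (chi_hom f) (chi_hom g).
Proof. exact: hopf_hom_ext. Qed.

Definition chi : functor (QHeapCat K) (HopfCat K) :=
  @Functor (QHeapCat K) (HopfCat K) chi_ob chi_hom chi_id chi_comp.

End Chi.

End Functors.

(* Main.v *)
Require Import Defs.
From mathcomp Require Import all_boot all_algebra.
From mathcomp Require Import boolp.

Set Implicit Arguments.
Unset Strict Implicit.
Unset Printing Implicit Defensive.

Import GRing.Theory.
Local Open Scope ring_scope.

(** Both functors keep the algebra, the counit and the underlying maps, so
    everything reduces to identities between structure maps, and these are
    Sweedler computations. A sum over the legs of [tau h] or [comul h] is
    expressed here by [tlift3 f (tau h)] or [tlift f (comul h)] with [f]
    multilinear; an axiom that equates two tensors becomes a rule rewriting such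
    sums ([heap_assoc], [heap_mul], [heap_mur], [hopf_coassoc],
    [hopf_antipode_l], and so on), and taking for [f] the universal multilinear
    map [pure] turns a computation back into an equality of tensors.

    Write [tau h] as the sum of a ⊗ b ⊗ c, and use e for the counit.

    From heaps to Hopf algebras, the comultiplication is the sum of
    e(b) a ⊗ c and the antipode the sum of e(a) e(c) b. Since e is an algebra
    map, e(a) e(b) = e(ab), so each pair of adjacent legs killed by e can be
    contracted with [heap_mul] or [heap_mur]; the Hopf axioms follow by moving
    the iterated [tau] with [heap_assoc] until such a pair appears
    ([chi_is_hopf]).

    From Hopf algebras to heaps, the only point that is not formal is that [tau]
    is multiplicative into H ⊗ H^op ⊗ H; this amounts to the antipode being an
    anti-homomorphism ([antipodeM]), because [tau] is then a composite of algebra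
    maps ([F_tau_alg]). The other axioms come from coassociativity and the
    antipode axioms ([F_is_heap]).

    The composite of the two constructions is the identity on objects:
    [chi_F_comul] rests on e ∘ S = e, [chi_F_antipode] on the counit axioms, and
    [F_chi_tau] uses heap associativity twice. Equality of functors then follows,
    as the axioms are propositions ([functor_ext], [hopf_hom_eq],
    [heap_hom_eq]). *)

(** * Sums over the legs of a tensor *)
Section Tlift.
Variable K : fieldType.
Implicit Types U V W X Y : lmodType K.

Lemma eq_tlift V W U (f g : V -> W -> U) (x : V ⊗ W) :
  (forall v w, f v w = g v w) -> tlift f x = tlift g x.
Proof. by move=> fg; apply: eq_bigr => p _. Qed.

Lemma tlift_exchange V W V' W' U (f : V -> W -> V' -> W' -> U)
    (x : V ⊗ W) (y : V' ⊗ W') :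
  tlift (fun v w => tlift (f v w) y) x =
  tlift (fun v' w' => tlift (fun v w => f v w v' w') x) y.
Proof. exact: exchange_big. Qed.

(** [tlift f x] is a finite sum over a fixed representative of [x]. With a [tlift]
    as [L], this gives the rules below for evaluating on an image. *)
Lemma lin_app_tlift V W U X (L : U -> X) (f : V -> W -> U) (x : V ⊗ W) :
  linear L -> L (tlift f x) = tlift (fun v w => L (f v w)) x.
Proof. by move=> lL; apply: (big_morph L (linD lL) (lin0 lL)). Qed.

(** With its analogues for three and five legs, this recovers a tensor from the
    sums over its legs: two tensors are equal as soon as these sums agree for
    all multilinear [f]. *)
Lemma tlift_pure_id V W (x : V ⊗ W) : tlift (@pure K V W) x = x.
Proof. by rewrite -[in RHS](tcls_repr x) tcls_sum. Qed.

Lemma tlift_tmap V V' W W' U (f : V' -> W' -> U) (g : V -> V') (g' : W -> W') x :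
  bilin f -> tlift f (tmap g g' x) = tlift (fun v w => f (g v) (g' w)) x.
Proof.
move=> fb; rewrite /tmap (lin_app_tlift _ _ (tlift_linear fb)).
by apply: eq_tlift => v w; rewrite tlift_pure.
Qed.

Lemma tassoc_linear U V W : linear (@tassoc K U V W).
Proof.
apply: tlift_linear; split=> [w | x k a b] /=; last first.
  by apply: tlift_comb => u v; rewrite !pure_linr.
apply: tlift_linear; split=> [v | u k a b] /=; first exact: pure_linl.
by rewrite pure_linl pure_linr.
Qed.

Definition trilin U V W X (f : U -> V -> W -> X) :=
  [/\ forall v w, linear (fun u => f u v w),
      forall u w, linear (fun v => f u v w)
    & forall u v, linear (fun w => f u v w)].

Definition tlift3 U V W X (f : U -> V -> W -> X) (x : U ⊗ (V ⊗ W)) : X :=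
  tlift (fun u => tlift (f u)) x.

Lemma trilin_bilin U V W X (f : U -> V -> W -> X) :
  trilin f -> bilin (fun u => tlift (f u)).
Proof.
case=> f1 f2 f3; split=> [y k a b | u] /=.
  by apply: tlift_comb => v w; exact: f1.
exact: tlift_linear.
Qed.

Lemma tlift3_linear U V W X (f : U -> V -> W -> X) : trilin f -> linear (tlift3 f).
Proof. by move=> /trilin_bilin /tlift_linear. Qed.

Lemma eq_tlift3 U V W X (f g : U -> V -> W -> X) x :
  (forall u v w, f u v w = g u v w) -> tlift3 f x = tlift3 g x.
Proof. by move=> fg; apply: eq_tlift => u y; apply: eq_tlift. Qed.

Lemma lin_app_tlift3 U V W X Y (L : X -> Y) (f : U -> V -> W -> X) x :
  linear L -> L (tlift3 f x) = tlift3 (fun u v w => L (f u v w)) x.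
Proof.
move=> lL; rewrite /tlift3 lin_app_tlift //; apply: eq_tlift => u y.
exact: lin_app_tlift.
Qed.

Lemma tlift3_comb U V W X (f g h : U -> V -> W -> X) (c : K) x :
  (forall u v w, f u v w = c *: g u v w + h u v w) ->
  tlift3 f x = c *: tlift3 g x + tlift3 h x.
Proof. by move=> fgh; apply: tlift_comb => u y; apply: tlift_comb. Qed.

Lemma tlift3_pure_id U V W (x : U ⊗ (V ⊗ W)) :
  tlift3 (fun u v w => pure u (pure v w)) x = x.
Proof.
rewrite -[RHS]tlift_pure_id; apply: eq_tlift => u y.
by rewrite -{2}[y]tlift_pure_id (lin_app_tlift _ _ (pure_linr u)).
Qed.

Lemma trilin_pure U V W :
  trilin (fun (u : U) (v : V) (w : W) => pure u (pure v w)).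
Proof.
split=> [v w | u w k x y | u v k x y].
- exact: pure_linl.
- by rewrite pure_linl pure_linr.
- by rewrite !pure_linr.
Qed.

Lemma tlift_tassoc U V W X (f : U -> V ⊗ W -> X) (x : (U ⊗ V) ⊗ W) :
  bilin f ->
  tlift f (tassoc x) = tlift (fun y w => tlift (fun u v => f u (pure v w)) y) x.
Proof.
move=> fb; rewrite /tassoc (lin_app_tlift _ _ (tlift_linear fb)).
apply: eq_tlift => y w; rewrite (lin_app_tlift _ _ (tlift_linear fb)).
by apply: eq_tlift => u v; rewrite tlift_pure.
Qed.

Lemma tlift_tassocV U V W X (f : U ⊗ V -> W -> X) (x : U ⊗ (V ⊗ W)) :
  bilin f -> tlift f (tassocV x) = tlift3 (fun u v w => f (pure u v) w) x.
Proof.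
move=> fb; rewrite /tassocV (lin_app_tlift _ _ (tlift_linear fb)).
apply: eq_tlift => u y; rewrite (lin_app_tlift _ _ (tlift_linear fb)).
by apply: eq_tlift => v w; rewrite tlift_pure.
Qed.

Lemma tlift3_tmap U U' V V' W W' X (f : U' -> V' -> W' -> X)
    (g : U -> U') (g' : V -> V') (g'' : W -> W') x : trilin f ->
  tlift3 f (tmap g (tmap g' g'') x) =
  tlift3 (fun u v w => f (g u) (g' v) (g'' w)) x.
Proof.
move=> fb; rewrite /tlift3 tlift_tmap; last exact: trilin_bilin.
by apply: eq_tlift => u y; rewrite tlift_tmap //; case: fb.
Qed.

Lemma lscale_lin V (v : V) : linear (fun a : K^o => (a : K) *: v).
Proof. by move=> k a b; rewrite scalerDl -scalerA. Qed.

Lemma scale_lin V (c : K) : linear (fun v : V => c *: v).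
Proof. by move=> k v w; rewrite scalerDr !scalerA mulrC. Qed.

Lemma scale_tlift V W X (c : K) (f : V -> W -> X) x :
  c *: tlift f x = tlift (fun v w => c *: f v w) x.
Proof. exact: (lin_app_tlift _ _ (scale_lin c)). Qed.

Lemma scale_tlift3 U V W X (c : K) (f : U -> V -> W -> X) x :
  c *: tlift3 f x = tlift3 (fun u v w => c *: f u v w) x.
Proof. exact: (lin_app_tlift3 _ _ (scale_lin c)). Qed.

Lemma tunitl_linear V : linear (@tunitl K V).
Proof.
apply: tlift_linear; split=> [v | a] /=; first exact: lscale_lin.
exact: scale_lin.
Qed.

Lemma tunitl_tmap V W W1 (e : V -> K^o) (g : W -> W1) x :
  tunitl (tmap e g x) = tlift (fun v w => (e v : K) *: g w) x.
Proof.
by apply: tlift_tmap; split=> [v | a] /=; [exact: lscale_lin | exact: scale_lin].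
Qed.

Lemma tunitr_tmap V V1 W (e : W -> K^o) (g : V -> V1) x :
  tunitr (tmap g e x) = tlift (fun v w => (e w : K) *: g v) x.
Proof.
by apply: tlift_tmap; split=> [a | v] /=; [exact: scale_lin | exact: lscale_lin].
Qed.

End Tlift.

(** * Algebra homomorphisms out of tensor products *)
Section AlgHom.
Variable K : fieldType.

Lemma mull_lin (A : algType K) (a : A) : linear (fun x => x * a).
Proof. by move=> k x y; rewrite mulrDl scalerAl. Qed.

Lemma mulr_lin (A : algType K) (a : A) : linear (fun x => a * x).
Proof. by move=> k x y; rewrite mulrDr scalerAr. Qed.

Lemma tmap_alg_hom (A A' B B' : algType K) (f : A -> A') (g : B -> B') :
  alg_hom f -> alg_hom g ->
  @alg_hom K (tensor_alg A B) (tensor_alg A' B') (tmap f g).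
Proof.
move=> [lf [f1 fM]] [lg [g1 gM]].
have lt := tmap_linear lf lg; split=> //; split=> [|x y].
  by rewrite [LHS]tmap_pure // f1 g1.
(* The product is exposed as [tmul], whose linearity in each argument reduces
   the claim to pure tensors. *)
rewrite -[x * y]/(tmul x y) -[RHS]/(tmul (tmap f g x) (tmap f g y)).
elim/tensor_ind: x => [|x x' Hx Hx'|a b].
- by rewrite !(lin0 lt, lin0 (tmul_linl _)).
- by rewrite !(linD lt, linD (tmul_linl _)) Hx Hx'.
elim/tensor_ind: y => [|y y' Hy Hy'|a' b'].
- by rewrite !(lin0 lt, lin0 (tmul_linr _)).
- by rewrite !(linD lt, linD (tmul_linr _)) Hy Hy'.
by rewrite !tmul_pure !tmap_pure // !tmul_pure fM gM.
Qed.

Lemma tunitl_alg_hom (A : algType K) :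
  @alg_hom K (tensor_alg K^o A) A (@tunitl K A).
Proof.
have lt := @tunitl_linear K A; split=> //; split=> [|x y].
  by rewrite [LHS]tunitl_pure scale1r.
rewrite -[x * y]/(tmul x y).
elim/tensor_ind: x => [|x x' Hx Hx'|a b].
- by rewrite (lin0 (tmul_linl _)) !(lin0 lt) mul0r.
- by rewrite !(linD lt, linD (tmul_linl _)) Hx Hx' mulrDl.
elim/tensor_ind: y => [|y y' Hy Hy'|a' b'].
- by rewrite (lin0 (tmul_linr _)) !(lin0 lt) mulr0.
- by rewrite !(linD lt, linD (tmul_linr _)) Hy Hy' mulrDr.
by rewrite tmul_pure !tunitl_pure -scalerAl -scalerAr scalerA.
Qed.

(** The ground field is commutative. *)
Lemma alg_hom_opp (A : algType K) (e : A -> K^o) :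
  alg_hom e -> @alg_hom K (opp_alg A) K^o e.
Proof.
move=> [le [e1 eM]]; split=> //; split=> // x y.
by rewrite [LHS](eM y x) mulrC.
Qed.

End AlgHom.

(** * Coassociativity against multilinear maps *)
Section Coassoc.
Variable K : fieldType.
Implicit Types A B X : lmodType K.

(** This lemma and the next evaluate the two sides of the coassociativity axiom
    of a comultiplication [d]. *)
Lemma tlift3_coassocl A X (d : A -> A ⊗ A) (f : A -> A -> A -> X) x :
  trilin f ->
  tlift3 f (tmap (@id A) d x) = tlift (fun a b => tlift (f a) (d b)) x.
Proof. by move=> fb; apply: tlift_tmap; exact: trilin_bilin. Qed.

Lemma tlift3_coassocr A X (d : A -> A ⊗ A) (f : A -> A -> A -> X) x :
  trilin f ->
  tlift3 f (tassoc (tmap d (@id A) x)) =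
  tlift (fun b c => tlift (fun a1 a2 => f a1 a2 c) (d b)) x.
Proof.
move=> fb; rewrite /tlift3 tlift_tassoc; last exact: trilin_bilin.
case: fb => f1 f2 f3; rewrite tlift_tmap; last first.
  split=> [c | y k a b] /=.
    apply: tlift_linear; split=> [v k a b | u k a b] /=.
      by apply: tlift_comb => *; rewrite f1.
    by rewrite pure_linl tlift_linear.
  by apply: tlift_comb => u v; rewrite pure_linr tlift_linear.
by apply: eq_tlift => b c; apply: eq_tlift => u v; rewrite tlift_pure.
Qed.

Lemma coassocl_bilin A X (d : A -> A ⊗ A) (f : A -> A -> A -> X) :
  linear d -> trilin f -> bilin (fun a b => tlift (f a) (d b)).
Proof.
move=> ld [f1 f2 f3]; split=> [b k a a' | a k b b'] /=.
  by apply: tlift_comb => u v; rewrite f1.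
by rewrite ld tlift_linear.
Qed.

Lemma coassocr_bilin A X (d : A -> A ⊗ A) (f : A -> A -> A -> X) :
  linear d -> trilin f -> bilin (fun b c => tlift (fun a1 a2 => f a1 a2 c) (d b)).
Proof.
move=> ld [f1 f2 f3]; split=> [c k b b' | b k c c'] /=.
  by rewrite ld tlift_linear.
by apply: tlift_comb => u v; rewrite f3.
Qed.

Lemma scalerCA (V : lmodType K) (a b : K) (v : V) : a *: (b *: v) = b *: (a *: v).
Proof. by rewrite !scalerA mulrC. Qed.

(** Every argument is covered: the first three by one conjunct, the last three
    by the other. *)
Definition quinlin A B X (f : A -> B -> A -> B -> A -> X) :=
  (forall a b, trilin (f a b)) /\ (forall d e, trilin (fun a b c => f a b c d e)).

Definition tlift5 A B X (f : A -> B -> A -> B -> A -> X) :=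
  tlift3 (fun a b => tlift3 (f a b)).

Lemma quinlin_trilin A B X (f : A -> B -> A -> B -> A -> X) :
  quinlin f -> trilin (fun a b => tlift3 (f a b)).
Proof.
case=> f1 f2; split=> [b y k u v | a y k u v | a b].
- by apply: tlift3_comb => c d e; case: (f2 d e) => ->.
- by apply: tlift3_comb => c d e; case: (f2 d e) => _ ->.
- exact: tlift3_linear.
Qed.

(** This lemma and the next evaluate the two sides of the associativity axiom
    of a ternary cooperation [t]. *)
Lemma tlift5_assocl A B X (t : A -> A ⊗ (B ⊗ A))
    (f : A -> B -> A -> B -> A -> X) x : quinlin f ->
  tlift5 f (tmap (@id A) (tmap (@id B) t) x) =
  tlift3 (fun a b c => tlift3 (f a b) (t c)) x.
Proof. by move=> fb; rewrite /tlift5 tlift3_tmap //; exact: quinlin_trilin. Qed.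

Lemma tlift5_assocr A B X (t : A -> A ⊗ (B ⊗ A))
    (f : A -> B -> A -> B -> A -> X) x : quinlin f ->
  tlift5 f (tmap (@id A) (@tassoc K B A (B ⊗ A)) (tassoc (tmap t (@id (B ⊗ A)) x)))
  = tlift3 (fun a d e => tlift3 (fun a1 a2 a3 => f a1 a2 a3 d e) (t a)) x.
Proof.
move=> fb; have := quinlin_trilin fb => gb; case: (fb) => f1 f2.
have [G1 G2] := trilin_bilin gb.
have gb' u : bilin (fun b => tlift3 (f u b)) by case: gb => _ g2 g3; split.
rewrite /tlift5 {1}/tlift3 tlift_tmap; last exact: trilin_bilin.
rewrite tlift_tassoc; last first.
  split=> [y | u k y z] /=; first exact: G1.
  by rewrite tassoc_linear G2.
rewrite tlift_tmap; last first.
  split=> [y | z k y y'] /=.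
    apply: tlift_linear; split=> [v k a b | u k v v'] /=; first by rewrite G1.
    by rewrite pure_linl tassoc_linear G2.
  by apply: tlift_comb => u v; rewrite pure_linr tassoc_linear G2.
apply: eq_tlift => a y; rewrite -[RHS]tlift_exchange.
apply: eq_tlift => u v; rewrite tlift_tassoc // tlift_pure; last first.
  split=> [w | w k p q] /=.
    apply: tlift_linear; split=> [b k c c' | c k b b'] /=; last first.
      by rewrite pure_linl; apply: (tlift3_linear (f1 _ _)).
    by apply: tlift3_comb => c1 d e; case: (f2 d e) => _ ->.
  apply: tlift_comb => b c; rewrite pure_linr.
  by apply: (tlift3_linear (f1 _ _)).
apply: etrans (tlift_exchange (f u) v y); apply: eq_tlift => b c.
by rewrite /tlift3 tlift_pure //; exact: trilin_bilin.
Qed.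

Lemma quinlin_pure A B : quinlin (fun (a : A) (b : B) (c : A) (d : B) (e : A) =>
  pure a (pure b (pure c (pure d e)))).
Proof.
split=> [a b | d e]; split=> u v k x y;
  by rewrite !(pure_linl, pure_linr).
Qed.

Lemma tlift5_pure_id A B (x : A ⊗ (B ⊗ (A ⊗ (B ⊗ A)))) :
  tlift5 (fun a b c d e => pure a (pure b (pure c (pure d e)))) x = x.
Proof.
rewrite -[RHS]tlift3_pure_id; apply: eq_tlift3 => a b y.
rewrite -{2}[y]tlift3_pure_id -[RHS]/((pure a \o pure b) _).
by rewrite lin_app_tlift3 //; apply: comp_linear; exact: pure_linr.
Qed.

End Coassoc.

(** * Rewriting rules in a quantum heap *)
Section HeapCalculus.
Variables (K : fieldType) (A : algType K) (t : A -> A ⊗ (A^c ⊗ A)).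
Hypothesis tP : is_quantum_heap t.
Implicit Type X : lmodType K.

Lemma heap_assoc X (f : A -> A^c -> A -> A^c -> A -> X) h : quinlin f ->
  tlift3 (fun a b c => tlift3 (f a b) (t c)) (t h) =
  tlift3 (fun a d e => tlift3 (fun a1 a2 a3 => f a1 a2 a3 d e) (t a)) (t h).
Proof.
by move=> fb; rewrite -tlift5_assocl // (tau_assoc tP) tlift5_assocr.
Qed.

Lemma mu_bilin : bilin (fun x y : A => x * y).
Proof. by split=> [y | x] /=; [exact: mull_lin | exact: mulr_lin]. Qed.

Lemma heap_mur X (f : A -> A -> X) h : bilin f ->
  tlift3 (fun a (b : A^c) c => f a ((b : A) * c)) (t h) = f h 1.
Proof.
move=> fb; rewrite -(tlift_pure h 1 fb) -(tau_mur tP) tlift_tmap //.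
apply: eq_tlift => a y; rewrite /mu_opp.
by rewrite (lin_app_tlift _ _ (fb.2 a)).
Qed.

Lemma heap_mul X (f : A -> A -> X) h : bilin f ->
  tlift3 (fun a (b : A^c) c => f (a * (b : A)) c) (t h) = f 1 h.
Proof.
move=> fb; rewrite -(tlift_pure 1 h fb) -(tau_mul tP) tlift_tmap //.
have lm : linear (@mu_copp K A) by exact: (tlift_linear mu_bilin).
rewrite tlift_tassocV; last first.
  split=> [c k x y | x] /=; first by rewrite lm fb.1.
  exact: fb.2.
by apply: eq_tlift3 => a b c; rewrite /mu_copp tlift_pure //; exact: mu_bilin.
Qed.

End HeapCalculus.

(** * The Hopf algebra of a copointed quantum heap *)
Section ChiData.
Variables (K : fieldType) (H : heap_data K).
Hypothesis HP : is_copointed_heap H.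
Implicit Type X : lmodType K.

Local Notation e := (@copoint K H).
Local Notation t := (@tau K H).

Let le : linear e := HP.2.1.
Let tP := HP.1.
Let lt : linear t := (tau_alg tP).1.

Lemma chi_comul X (f : H -> H -> X) h : bilin f ->
  tlift f (@comul K (chi_data H) h) =
  tlift3 (fun a b c => (e b : K) *: f a c) (t h).
Proof.
move=> fb; rewrite /= tlift_tmap //; apply: eq_tlift => a y /=.
rewrite tunitl_tmap (lin_app_tlift _ _ (fb.2 a)).
by apply: eq_tlift => b c; rewrite (linZ (fb.2 a)).
Qed.

Lemma chi_antipode h :
  @antipode K (chi_data H) h =
  tlift3 (fun a b c => (e a : K) *: ((e c : K) *: (b : H))) (t h).
Proof.
rewrite [LHS]tunitl_tmap; apply: eq_tlift => a y /=.
by rewrite tunitr_tmap; exact: (lin_app_tlift _ _ (@scale_lin K H^c (e a))).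
Qed.

Lemma chi_comul_alg :
  @alg_hom K H (tensor_alg H H) (@comul K (chi_data H)).
Proof.
apply: (alg_hom_comp (B := heap_alg H)) (tau_alg tP).
apply: tmap_alg_hom; first exact: alg_hom_id.
apply: alg_hom_comp; first exact: tunitl_alg_hom.
apply: (tmap_alg_hom (A := opp_alg H)); last exact: alg_hom_id.
exact: alg_hom_opp HP.2.
Qed.

Lemma chi_comul_linear : linear (@comul K (chi_data H)).
Proof. exact: chi_comul_alg.1. Qed.

Lemma chi_antipode_linear : linear (@antipode K (chi_data H)).
Proof.
move=> k x y; rewrite !chi_antipode lt; apply: tlift3_linear.
split=> [b c | a c | a b] k' u v.
- by rewrite le lscale_lin.
- by rewrite !scale_lin.
- by rewrite le lscale_lin scale_lin.
Qed.

(** Both sides are the sum of e(x2) e(x4) x1 ⊗ x3 ⊗ x5 over the five legs of the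
    iterated cooperation. *)
Lemma chi_coassoc h :
  tmap (@id H) (@comul K (chi_data H)) (@comul K (chi_data H) h) =
  tassoc (tmap (@comul K (chi_data H)) (@id H) (@comul K (chi_data H) h)).
Proof.
rewrite -[LHS]tlift3_pure_id -[RHS]tlift3_pure_id.
have pb := @trilin_pure K H H H.
rewrite tlift3_coassocl // tlift3_coassocr //.
have lc := chi_comul_linear.
rewrite !chi_comul; [|exact: coassocr_bilin|exact: coassocl_bilin].
pose f (x1 : H) (x2 : H^c) x3 (x4 : H^c) x5 : H ⊗ (H ⊗ H) :=
  (e x2 : K) *: ((e x4 : K) *: pure x1 (pure x3 x5)).
transitivity (tlift3 (fun a b c => tlift3 (f a b) (t c)) (t h)).
  apply: eq_tlift3 => a b c; rewrite chi_comul; last by split=> u; case: pb.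
  by rewrite scale_tlift3.
rewrite heap_assoc //; last first.
  split=> [a b | c d]; split=> u v k x y; rewrite /f;
    by rewrite !(le, lscale_lin, pure_linl, pure_linr, scale_lin).
apply: eq_tlift3 => a b c; rewrite chi_comul; last by split=> u; case: pb.
rewrite scale_tlift3.
by apply: eq_tlift3 => u v w; exact: scalerCA.
Qed.

Let eM x y : e (x * y) = e x * e y. Proof. exact: HP.2.2.2. Qed.
Let e1 : e 1 = 1. Proof. exact: HP.2.2.1. Qed.

(** The counit kills the first two legs a, b; as e(a) e(b) = e(ab), [heap_mul]
    contracts them. *)
Lemma chi_counit_l h : tunitl (tmap e (@id H) (@comul K (chi_data H) h)) = h.
Proof.
rewrite tunitl_tmap chi_comul; last first.
  by split=> [b | a] /= k x y; rewrite ?le (lscale_lin, scale_lin).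
have fb : bilin (fun a c : H => (e a : K) *: c).
  by split=> [b | a] /= k x y; rewrite ?le (lscale_lin, scale_lin).
rewrite -[RHS]scale1r -e1 -[RHS](heap_mul tP h fb).
by apply: eq_tlift3 => a b c; rewrite eM scalerA mulrC.
Qed.

Lemma chi_counit_r h : tunitr (tmap (@id H) e (@comul K (chi_data H) h)) = h.
Proof.
have fb : bilin (fun c a : H => (e a : K) *: c).
  by split=> [b | a] /= k x y; rewrite ?le (lscale_lin, scale_lin).
rewrite tunitr_tmap chi_comul //.
rewrite -[RHS]scale1r -e1 -[RHS](heap_mur tP h fb).
by apply: eq_tlift3 => a b c; rewrite eM scalerA.
Qed.

(** Expanding the antipode of the first leg gives the sum of
    e(x4) e(x1) e(x3) x2 x5 over the five legs with [tau] applied to the first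
    one. Once [heap_assoc] moves this [tau] to the last leg, x3 and x4 are
    adjacent legs of it and contract, then x2 x5 contracts as well. *)
Lemma chi_antipode_l h :
  mu (tmap (@antipode K (chi_data H)) (@id H) (@comul K (chi_data H) h)) =
  (e h : K)%:A.
Proof.
have lS := chi_antipode_linear.
rewrite /mu tlift_tmap; last exact: mu_bilin.
rewrite chi_comul; last first.
  by split=> [b | a] k x y; rewrite ?lS (mull_lin, mulr_lin).
pose f (x1 : H) (x2 : H^c) x3 (x4 : H^c) x5 : H :=
  (e x4 : K) *: ((e x1 : K) *: ((e x3 : K) *: ((x2 : H) * x5))).
transitivity (tlift3 (fun a d c => tlift3 (fun a1 a2 a3 => f a1 a2 a3 d c) (t a))
    (t h)).
  apply: eq_tlift3 => a b c; rewrite chi_antipode.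
  rewrite (lin_app_tlift3 _ _ (mull_lin c)).
  rewrite scale_tlift3.
  by apply: eq_tlift3 => u v w; rewrite -!scalerAl.
rewrite -heap_assoc //; last first.
  split=> [a b | c d]; split=> u v k x y; rewrite /f;
    by rewrite !(le, lscale_lin, mull_lin, mulr_lin, scale_lin).
pose g a (b : H) (u v : H) : H := (e u : K) *: ((e a : K) *: (b * v)).
have gb a b : bilin (g a b).
  split=> [u | v] k x y; rewrite /g;
    by rewrite !(le, lscale_lin, mull_lin, mulr_lin, scale_lin).
transitivity (tlift3 (fun a (b : H^c) c => (e a : K) *: ((b : H) * c)) (t h)).
  apply: eq_tlift3 => a b c.
  transitivity (g a b 1 c); last by rewrite /g e1 scale1r.
  rewrite -(heap_mul tP _ (gb a b)); apply: eq_tlift3 => x y z.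
  by rewrite /g /f eM -scalerA [RHS]scalerCA; congr (_ *: _); exact: scalerCA.
have fb : bilin (fun a b : H => (e a : K) *: b).
  by split=> [b | a] /= k x y; rewrite ?le (lscale_lin, scale_lin).
exact: (heap_mur tP h fb).
Qed.

(** Mirror image of the previous computation: x2 and x3 contract, then x1 x4. *)
Lemma chi_antipode_r h :
  mu (tmap (@id H) (@antipode K (chi_data H)) (@comul K (chi_data H) h)) =
  (e h : K)%:A.
Proof.
have lS := chi_antipode_linear.
rewrite /mu tlift_tmap; last exact: mu_bilin.
rewrite chi_comul; last first.
  by split=> [b | a] k x y; rewrite ?lS (mull_lin, mulr_lin).
pose f (x1 : H) (x2 : H^c) x3 (x4 : H^c) x5 : H :=
  (e x2 : K) *: ((e x3 : K) *: ((e x5 : K) *: (x1 * (x4 : H)))).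
transitivity (tlift3 (fun a b c => tlift3 (f a b) (t c)) (t h)).
  apply: eq_tlift3 => a b c; rewrite chi_antipode.
  rewrite (lin_app_tlift3 _ _ (mulr_lin a)).
  rewrite scale_tlift3.
  by apply: eq_tlift3 => u v w; rewrite -!scalerAr.
rewrite heap_assoc //; last first.
  split=> [a b | c d]; split=> u v k x y; rewrite /f;
    by rewrite !(le, lscale_lin, mull_lin, mulr_lin, scale_lin).
pose g c (b : H) (u v : H) : H := (e v : K) *: ((e c : K) *: (u * b)).
have gb c b : bilin (g c b).
  split=> [u | v] k x y; rewrite /g;
    by rewrite !(le, lscale_lin, mull_lin, mulr_lin, scale_lin).
transitivity (tlift3 (fun a (b : H^c) c => (e c : K) *: (a * (b : H))) (t h)).
  apply: eq_tlift3 => a b c.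
  transitivity (g c b a 1); last by rewrite /g e1 scale1r.
  rewrite -(heap_mur tP _ (gb c b)); apply: eq_tlift3 => x y z.
  by rewrite /g /f eM -scalerA.
have fb : bilin (fun b a : H => (e a : K) *: b).
  by split=> [b | a] /= k x y; rewrite ?le (lscale_lin, scale_lin).
exact: (heap_mul tP h fb).
Qed.

Lemma chi_is_hopf : is_hopf (chi_data H).
Proof.
split; [exact: chi_comul_alg | exact: HP.2 | exact: chi_antipode_linear |
  exact: chi_coassoc | exact: chi_counit_l | exact: chi_counit_r |
  exact: chi_antipode_l | exact: chi_antipode_r].
Qed.

(** The left-hand side is h1 ⊗ S h2 ⊗ h3; expanding the comultiplication and the
    antipode in terms of [tau] involves three cooperations. Two uses of
    [heap_assoc], each followed by the contraction of two adjacent legs, remove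
    two of them. *)
Lemma F_chi_tau h : tau (h : F_data (chi_data H)) = t h.
Proof.
have lc := chi_comul_linear.
rewrite -[LHS]tlift3_pure_id -[RHS]tlift3_pure_id.
have pb := @trilin_pure K H H^c H.
(* The antipode is abstracted as a map into the opposite algebra, to fix the
   vector space structure in which its linearity is used. *)
have [S SE lS] : exists2 S : H -> H^c, S = @antipode K (chi_data H) & linear S.
  by exists (@antipode K (chi_data H)); last exact: chi_antipode_linear.
transitivity (tlift3 (fun (u : H) (v : H) (w : H) => pure u (pure (S v) w))
   (tmap (@id H) (@comul K (chi_data H)) (@comul K (chi_data H) h))).
  by rewrite SE; exact: tlift3_tmap.
have pbS : trilin (fun (u : H) (v : H) (w : H) => pure u (pure (S v) w)).
  by split=> v w k x y; rewrite ?lS !(pure_linl, pure_linr).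
rewrite tlift3_coassocl // chi_comul; last exact: coassocl_bilin.
(* Here a and b are the first legs of [tau h], whose third leg c is split into
   c1, c2, c3 and then c1 into x1, x2, x3; x4 and x5 are c2 and c3. *)
pose f a (b : H^c) (x1 : H) (x2 : H^c) x3 (x4 : H^c) x5 : H ⊗ (H^c ⊗ H) :=
  (e b : K) *: ((e x4 : K) *: ((e x1 : K) *:
    ((e x3 : K) *: pure a (pure x2 x5)))).
transitivity (tlift3 (fun a b c => tlift3 (fun a' d c' =>
    tlift3 (fun x1 x2 x3 => f a b x1 x2 x3 d c') (t a')) (t c)) (t h)).
  apply: eq_tlift3 => a b c; rewrite chi_comul; last by split=> u; case: pbS.
  rewrite scale_tlift3.
  apply: eq_tlift3 => u v w; rewrite SE chi_antipode.
  rewrite -[LHS]/((fun x => (e b : K) *: ((e v : K) *: pure a (pure x w))) _).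
  rewrite lin_app_tlift3; last first.
    move=> k x y; rewrite (@pure_linl K H^c H w k x y).
    by rewrite !(pure_linr, scale_lin).
  apply: eq_tlift3 => x y z; rewrite /f; congr (_ *: (_ *: _)).
  by rewrite (linZ (pure_linl w)) (linZ (pure_linl w)) !(linZ (pure_linr a)).
(* First contraction: x3 and x4 become the first two legs of the third leg of
   [tau c]. *)
pose g a (b : H^c) x2 x1 x5 : H ⊗ (H^c ⊗ H) :=
  (e b : K) *: ((e x1 : K) *: pure a (pure (x2 : H^c) x5)).
transitivity (tlift3 (fun a b c => tlift3 (fun x1 x2 x5 => g a b x2 x1 x5) (t c))
    (t h)).
  apply: eq_tlift3 => a b c; rewrite -heap_assoc //; last first.
    split=> [x y | x y]; split=> u v k p q; rewrite /f;
      by rewrite !(le, lscale_lin, pure_linl, pure_linr, scale_lin).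
  apply: eq_tlift3 => x1 x2 d.
  pose m u v : H ⊗ (H^c ⊗ H) := (e u : K) *: (g a b x2 x1 v).
  have mb : bilin m.
    by split=> v k p q; rewrite /m /g
      !(le, lscale_lin, pure_linl, pure_linr, scale_lin).
  rewrite -[RHS]scale1r -[in RHS]e1 -[RHS](heap_mul tP d mb).
  apply: eq_tlift3 => u v w; rewrite /m /g /f eM -scalerA.
  rewrite (@scalerCA K _ (e x1) (e u)) (@scalerCA K _ (e v) (e u)).
  by rewrite (@scalerCA K _ (e b) (e u)) (@scalerCA K _ (e b) (e v)).
(* Second contraction: b and x1 become the last two legs of the first leg of
   [tau h]. *)
rewrite (heap_assoc tP (f := fun a b x1 x2 x5 => g a b x2 x1 x5)); last first.
  split=> [x y | x y]; split=> u v k p q; rewrite /g;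
    by rewrite !(le, lscale_lin, pure_linl, pure_linr, scale_lin).
apply: eq_tlift3 => a b c.
pose m u v : H ⊗ (H^c ⊗ H) := (e v : K) *: pure u (pure b c).
have mb : bilin m.
  by split=> v k p q; rewrite /m
    !(le, lscale_lin, pure_linl, pure_linr, scale_lin).
rewrite -[RHS]scale1r -[in RHS]e1 -[RHS](heap_mur tP a mb).
by apply: eq_tlift3 => u v w; rewrite /m /g eM -scalerA.
Qed.

End ChiData.

(** * The copointed quantum heap of a Hopf algebra *)
Section HopfCalculus.
Variables (K : fieldType) (H : hopf_data K).
Hypothesis HP : is_hopf H.
Implicit Type X : lmodType K.

Local Notation e := (@counit K H).
Local Notation D := (@comul K H).
Local Notation S := (@antipode K H).

Let lD : linear D := (comul_alg HP).1.
Let le : linear e := (counit_alg HP).1.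
Let lS : linear S := antipode_linear HP.
Let eM x y : e (x * y) = e x * e y. Proof. exact: (counit_alg HP).2.2. Qed.
Let e1 : e 1 = 1. Proof. exact: (counit_alg HP).2.1. Qed.

Lemma hopf_coassoc X (f : H -> H -> H -> X) h : trilin f ->
  tlift (fun a b => tlift (f a) (D b)) (D h) =
  tlift (fun b c => tlift (fun a1 a2 => f a1 a2 c) (D b)) (D h).
Proof.
by move=> fb; rewrite -tlift3_coassocl // comul_coassoc // tlift3_coassocr.
Qed.

Lemma hopf_counit_l X (g : H -> X) h : linear g ->
  tlift (fun a b => (e a : K) *: g b) (D h) = g h.
Proof.
move=> lg; rewrite -[in RHS](counit_l HP h) tunitl_tmap (lin_app_tlift _ _ lg).
by apply: eq_tlift => a b; rewrite (linZ lg).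
Qed.

Lemma hopf_counit_r X (g : H -> X) h : linear g ->
  tlift (fun a b => (e b : K) *: g a) (D h) = g h.
Proof.
move=> lg; rewrite -[in RHS](counit_r HP h) tunitr_tmap (lin_app_tlift _ _ lg).
by apply: eq_tlift => a b; rewrite (linZ lg).
Qed.

Lemma hopf_antipode_l X (g : H -> X) h : linear g ->
  tlift (fun a b => g (S a * b)) (D h) = (e h : K) *: g 1.
Proof.
move=> lg; rewrite -(linZ lg) -(antipode_l HP) /mu tlift_tmap; last exact: mu_bilin.
by rewrite (lin_app_tlift _ _ lg).
Qed.

Lemma hopf_antipode_r X (g : H -> X) h : linear g ->
  tlift (fun a b => g (a * S b)) (D h) = (e h : K) *: g 1.
Proof.
move=> lg; rewrite -(linZ lg) -(antipode_r HP) /mu tlift_tmap; last exact: mu_bilin.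
by rewrite (lin_app_tlift _ _ lg).
Qed.

Lemma hopf_comulM X (f : H -> H -> X) x y : bilin f ->
  tlift f (D (x * y)) =
  tlift (fun a b => tlift (fun a' b' => f (a * a') (b * b')) (D y)) (D x).
Proof.
move=> fb; rewrite (comul_alg HP).2.2 -[D x * D y]/(tmul (D x) (D y)) /tmul.
rewrite (lin_app_tlift _ _ (tlift_linear fb)); apply: eq_tlift => a b.
rewrite (lin_app_tlift _ _ (tlift_linear fb)); apply: eq_tlift => a' b'.
by rewrite tlift_pure.
Qed.

Lemma antipode1 : S 1 = 1.
Proof.
have := antipode_l HP 1; rewrite e1 scale1r => E; rewrite -[RHS]E {E}.
rewrite (comul_alg HP).2.1 /mu tlift_tmap; last exact: mu_bilin.
rewrite [RHS]tlift_pure ?mulr1 //.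
by split=> [b | a] k x y; rewrite ?lS (mull_lin, mulr_lin).
Qed.

(** e(S h) is the sum of e(S h1) e(h2) = e(S(h1) h2), hence
    e(e(h) 1) = e(h). *)
Lemma counit_antipode h : e (S h) = e h.
Proof.
rewrite -[h in LHS](counit_r HP) tunitr_tmap (lin_app_tlift _ _ lS).
rewrite (lin_app_tlift _ _ le).
have := hopf_antipode_l h le; rewrite e1 [RHS]mulr1 => <-.
by apply: eq_tlift => a b; rewrite (linZ lS) (linZ le) eM [RHS]mulrC.
Qed.

(** Uniqueness of convolution inverses, in Sweedler form: both sides equal the
    sum of S(x1 y1) x2 y2 S(y3) S(x3). Contracting x2 y2 S(y3) S(x3) from the
    inside leaves S(xy); contracting S(x1 y1) x2 y2, which is S(z1) z2 summed
    over the legs of a product z, leaves S(y) S(x). *)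
Lemma antipodeM x y : S (x * y) = S y * S x.
Proof.
pose f a b c a' b' c' : H := S (a * a') * (b * b' * (S c' * S c)).
transitivity (tlift (fun a b => tlift (fun a' b' =>
  tlift (fun b1 b2 => tlift (f a b1 b2 a') (D b')) (D b)) (D y)) (D x)).
  rewrite -(hopf_counit_r x (g := fun x => S (x * y))); last first.
    by move=> k u v; rewrite mull_lin lS.
  apply: eq_tlift => a b.
  rewrite -(hopf_counit_r y (g := fun y => S (a * y))); last first.
    by move=> k u v; rewrite mulr_lin lS.
  rewrite scale_tlift; apply: eq_tlift => a' b'.
  transitivity (tlift (fun b1 b2 => (e b' : K) *: (S (a * a') * (b1 * S b2))) (D b)).
    rewrite (hopf_antipode_r b (g := fun z => (e b' : K) *: (S (a * a') * z))).
      by rewrite mulr1.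
    by move=> k u v; rewrite mulr_lin scale_lin.
  apply: eq_tlift => b1 b2.
  have lg : linear (fun z => S (a * a') * (b1 * z * S b2)).
    by move=> k u v; rewrite mulr_lin mull_lin mulr_lin.
  have := hopf_antipode_r b' lg; rewrite /= mulr1 => <-.
  by apply: eq_tlift => u v; rewrite /f !mulrA.
have fx a' b' c' : trilin (fun a b c => f a b c a' b' c').
  by split=> u v k p q; rewrite /f
   !(lS, mull_lin, mulr_lin).
have fy a b c : trilin (f a b c).
  by split=> u v k p q; rewrite /f
   !(lS, mull_lin, mulr_lin).
(* Coassociativity moves the inner splitting to the first leg, once for x and
   once for y. *)
rewrite tlift_exchange.
transitivity (tlift (fun a' b' => tlift (fun u c => tlift (fun a b =>
    tlift (f a b c a') (D b')) (D u)) (D x)) (D y)).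
  apply: eq_tlift => a' b'.
  apply: (hopf_coassoc (f := fun a b c => tlift (f a b c a') (D b'))).
  split=> u v k p q; apply: tlift_comb => b2 c2;
    by case: (fx a' b2 c2) => f1 f2 f3; rewrite (f1, f2, f3).
rewrite tlift_exchange.
transitivity (tlift (fun u c => tlift (fun u' c' => tlift (fun a' b' =>
    tlift (fun a b => f a b c a' b' c') (D u)) (D u')) (D y)) (D x)).
  apply: eq_tlift => u c.
  rewrite -(hopf_coassoc (f := fun a' b' c' => tlift (fun a b => f a b c a' b' c') (D u))).
    by apply: eq_tlift => a' b'; rewrite tlift_exchange.
  split=> v w k p q; apply: tlift_comb => a b;
    by case: (fy a b c) => f1 f2 f3; rewrite (f1, f2, f3).
rewrite -(hopf_counit_l x (g := fun x => S y * S x)); last first.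
  by move=> k u v; rewrite lS mulr_lin.
apply: eq_tlift => u c.
rewrite -(hopf_counit_l y (g := fun y => S y * S c)); last first.
  by move=> k p v; rewrite lS mull_lin.
rewrite scale_tlift; apply: eq_tlift => u' c'.
have lg : linear (fun z => z * (S c' * S c)) by move=> k p q; rewrite mull_lin.
have := hopf_antipode_l (u * u') lg; rewrite mul1r eM -scalerA => <-.
rewrite hopf_comulM; last first.
  by split=> p k q r; rewrite ?lS !(mull_lin, mulr_lin).
rewrite tlift_exchange; apply: eq_tlift => a' b'; apply: eq_tlift => a b.
by rewrite /f mulrA.
Qed.

Local Notation t := (@tau K (F_data H)).

Lemma F_tauE X (f : H -> H^c -> H -> X) h : trilin f ->
  tlift3 f (t h) =
  tlift (fun a b => tlift (fun b1 b2 => f a (S b1) b2) (D b)) (D h).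
Proof.
move=> fb; rewrite [LHS](tlift3_tmap _ (S : H -> H^c)) // tlift3_coassocl //.
case: fb => f1 f2 f3; split=> u v k p q; rewrite ?lS.
- exact: f1.
- exact: f2.
- exact: f3.
Qed.

Lemma F_tau_alg : @alg_hom K H (heap_alg H) t.
Proof.
have SP : @alg_hom K H (opp_alg H) S.
  by split; [exact: lS | split=> [|x y]; [exact: antipode1 | exact: antipodeM]].
have Dc := comul_alg HP; have idP := @alg_hom_id K H.
apply: (alg_hom_comp (B := tensor_alg H (tensor_alg H H))
  (f := tmap (@id H) (tmap (S : H -> H^c) (@id H)))
  (g := fun h => tmap (@id H) D (D h))).
  exact: tmap_alg_hom idP (tmap_alg_hom SP idP).
exact: (alg_hom_comp (B := tensor_alg H H) (tmap_alg_hom idP Dc) Dc).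
Qed.

(** Both sides are the sum of f(h1, S h2, h3, S h4, h5). *)
Lemma F_tau_assoc X (f : H -> H^c -> H -> H^c -> H -> X) h : quinlin f ->
  tlift3 (fun a b c => tlift3 (f a b) (t c)) (t h) =
  tlift3 (fun a d e => tlift3 (fun a1 a2 a3 => f a1 a2 a3 d e) (t a)) (t h).
Proof.
move=> fb; have lt := F_tau_alg.1; have [f1 f2] := fb.
(* The comultiplication producing h4 and h5 is hidden inside [G], and the one
   producing h2 and h3 inside [M]: two applications of coassociativity suffice,
   the rest being exchanges of sums. *)
pose G a b1 c d := tlift (fun d1 d2 => f a (S b1) c (S d1) d2) (D d).
pose M a u d := tlift (fun b1 c => G a b1 c d) (D u).
have G3 a b c : linear (G a b c).
  move=> k p q; rewrite /G lD tlift_linear //.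
  by case: (f1 a (S b)) => _ g2 g3; split=> u v x y; rewrite ?lS ?g2 ?g3.
have Ga b1 c d : linear (fun a => G a b1 c d).
  by move=> k p q; apply: tlift_comb => d1 d2; case: (f2 (S d1) d2) => ->.
have Gtri a : trilin (G a).
  split=> [c d k p q | b d k p q | //]; apply: tlift_comb => d1 d2;
    by case: (f2 (S d1) d2) => _ g2 g3; rewrite ?lS ?g2 ?g3.
have Mtri : trilin M.
  split=> [u d k p q | a d k p q | a u k p q].
  - by apply: tlift_comb => b1 c; exact: Ga.
  - rewrite /M lD tlift_linear //.
    by case: (Gtri a) => g1 g2 _; split.
  - by apply: tlift_comb => b1 c; exact: G3.
transitivity (tlift (fun a b => tlift (M a) (D b)) (D h)).
  rewrite F_tauE; last first.
    have [g1 g2 _] := quinlin_trilin fb.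
    split=> [b c | a c | a b k p q]; [exact: g1 | exact: g2 |].
    by rewrite lt tlift3_linear.
  apply: eq_tlift => a b; rewrite /M -(hopf_coassoc _ (Gtri a)).
  by apply: eq_tlift => b1 b2; rewrite F_tauE.
rewrite hopf_coassoc // F_tauE; last first.
  split=> [d e' k p q | a e' k p q | a d k p q].
  - by rewrite lt tlift3_linear.
  - by apply: tlift3_comb => u v w; case: (f1 u v) => _ ->.
  - by apply: tlift3_comb => u v w; case: (f1 u v) => _ _ ->.
apply: eq_tlift => p d.
transitivity (tlift (fun d1 d2 => tlift (fun a u => tlift (fun b1 c =>
    f a (S b1) c (S d1) d2) (D u)) (D p)) (D d)); last first.
  by apply: eq_tlift => d1 d2; rewrite F_tauE.
rewrite [RHS]tlift_exchange; apply: eq_tlift => a u.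
by rewrite [RHS]tlift_exchange.
Qed.

Lemma F_is_heap : is_copointed_heap (F_data H).
Proof.
split; last exact: counit_alg.
split=> [|h|h|h]; first exact: F_tau_alg.
- rewrite -[LHS]tlift5_pure_id -[RHS]tlift5_pure_id.
  have fb := @quinlin_pure K H H^c.
  by rewrite [LHS]tlift5_assocl // [RHS]tlift5_assocr // [LHS]F_tau_assoc.
- rewrite -[LHS]tlift_pure_id -[RHS](hopf_counit_r h (pure_linl 1)).
  rewrite tlift_tmap; last exact: pure_bilin.
  transitivity (tlift3 (fun a (b : H^c) c => pure a ((b : H) * c)) (t h)).
    apply: eq_tlift => a y.
    by rewrite /mu_opp (lin_app_tlift _ _ (pure_linr a)).
  rewrite F_tauE; last first.
    by split=> u v k p q; rewrite ?(mull_lin, mulr_lin) !(pure_linl, pure_linr).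
  apply: eq_tlift => a b.
  by rewrite (hopf_antipode_l b (pure_linr a)).
- rewrite -[LHS]tlift_pure_id -[RHS](hopf_counit_l h (pure_linr 1)).
  have lm : linear (@mu_copp K H) by exact: (tlift_linear (mu_bilin H)).
  rewrite tlift_tmap; last exact: pure_bilin.
  rewrite tlift_tassocV; last first.
    by split=> u k p q; rewrite ?lm !(pure_linl, pure_linr).
  transitivity (tlift3 (fun a (b : H^c) c => pure (a * (b : H)) c) (t h)).
    apply: eq_tlift3 => a b c.
    by rewrite /mu_copp tlift_pure //; exact: mu_bilin.
  rewrite F_tauE; last first.
    by split=> u v k p q; rewrite ?(mull_lin, mulr_lin) !(pure_linl, pure_linr).
  rewrite (hopf_coassoc (f := fun a b c => pure (a * S b) c)); last first.
    by split=> u v k p q; rewrite ?lS ?(mull_lin, mulr_lin) !(pure_linl, pure_linr).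
  apply: eq_tlift => a b.
  by rewrite (hopf_antipode_r a (pure_linl b)).
Qed.

Lemma chi_F_comul h : comul (h : chi_data (F_data H)) = D h.
Proof.
rewrite -[LHS]tlift_pure_id -[RHS]tlift_pure_id.
rewrite (chi_comul (H := F_data H)); last exact: pure_bilin.
have lc : linear (@copoint K (F_data H)) := le.
rewrite F_tauE; last first.
  by split=> u v k p q; rewrite !(lc, lscale_lin, pure_linl, pure_linr, scale_lin).
apply: eq_tlift => a b.
rewrite -(hopf_counit_l b (pure_linr a)); apply: eq_tlift => u v.
by rewrite /= counit_antipode.
Qed.

Lemma chi_F_antipode h : antipode (h : chi_data (F_data H)) = S h.
Proof.
rewrite [LHS](chi_antipode (H := F_data H)).
have lc : linear (@copoint K (F_data H)) := le.
rewrite F_tauE; last first.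
  by split=> u v k p q; rewrite !(lc, lscale_lin, scale_lin).
rewrite -[RHS](hopf_counit_l h lS); apply: eq_tlift => a b.
rewrite -(hopf_counit_r b lS) scale_tlift; apply: eq_tlift => u v.
by [].
Qed.

End HopfCalculus.

(** * Morphisms *)
Section Morphisms.
Variable K : fieldType.

Lemma F_is_hom (H H' : hopf_data K) (f : H -> H') :
  is_hopf H -> is_hopf H' -> is_hopf_hom f ->
  @is_heap_hom K (F_data H) (F_data H') f.
Proof.
move=> HP HP' [fA fD fe fS]; split=> // h.
have lf := fA.1.
rewrite -[LHS]tlift3_pure_id -[RHS]tlift3_pure_id.
have pb := @trilin_pure K H' H'^c H'.
rewrite (F_tauE HP') // tlift3_tmap // (F_tauE HP); last first.
  by split=> u v k p q; rewrite lf !(pure_linl, pure_linr).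
rewrite fD tlift_tmap; last first.
  apply: (coassocl_bilin (f := fun a b c => pure a (pure (antipode b : H'^c) c))).
    exact: (comul_alg HP').1.
  by split=> u v k p q; rewrite ?(antipode_linear HP') !(pure_linl, pure_linr).
apply: eq_tlift => a b; rewrite fD tlift_tmap; last first.
  by split=> u k p q; rewrite ?(antipode_linear HP') !(pure_linl, pure_linr).
by apply: eq_tlift => u v; rewrite fS.
Qed.

Lemma chi_is_hom (H H' : heap_data K) (f : H -> H') :
  is_copointed_heap H -> is_copointed_heap H' -> is_heap_hom f ->
  @is_hopf_hom K (chi_data H) (chi_data H') f.
Proof.
move=> HP HP' [fA ft fe]; have lf := fA.1; have le' := HP'.2.1.
split=> // h.
- rewrite -[LHS]tlift_pure_id -[RHS]tlift_pure_id.
  have pb := @pure_bilin K H' H'.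
  rewrite (chi_comul (H := H')) // ft tlift_tmap // (chi_comul (H := H)); last first.
    by split=> u k p q; rewrite lf !(pure_linl, pure_linr).
  rewrite tlift3_tmap; last first.
    by split=> u v k p q; rewrite !(le', lscale_lin, pure_linl, pure_linr, scale_lin).
  by apply: eq_tlift3 => a b c; rewrite fe.
- rewrite (chi_antipode (H := H')) (chi_antipode (H := H)) ft tlift3_tmap; last first.
    by split=> u v k p q; rewrite !(le', lscale_lin, scale_lin).
  rewrite (lin_app_tlift3 _ _ lf); apply: eq_tlift3 => a b c.
  by rewrite !fe !(linZ lf).
Qed.

End Morphisms.

(** * Strict equality of functors *)
Section FunctorEquality.

(** The images of a morphism under the two functors have types that differ by
    the equality of objects to be proved. Packing each with its source and target
    avoids transport and makes the equality on objects part of the hypothesis,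
    through the images of the identities. *)
Lemma functor_ext (C D : category) (F G : functor C D) :
  (forall X Y (f : mor X Y),
    existT (fun p : D * D => mor p.1 p.2) (F X, F Y) (fmor F f) =
    existT (fun p : D * D => mor p.1 p.2) (G X, G Y) (fmor G f)) ->
  F = G.
Proof.
case: F G => [Fo Fm Fi Fc] [Go Gm Gi Gc] /= FG.
have E : Fo = Go.
  by apply: funext => X; have [] := congr1 (fun p => (projT1 p).1) (FG X X (idm X)).
subst Go.
have E : Fm = Gm.
  apply: functional_extensionality_dep => X; apply: functional_extensionality_dep => Y.
  apply: functional_extensionality_dep => f.
  move: (projT1_eq (FG X Y f)) (projT2_eq (FG X Y f)) => /= q.
  by rewrite (Prop_irrelevance q erefl).
subst Gm; congr Functor; exact: Prop_irrelevance.
Qed.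

Variable K : fieldType.

(** Once the structure maps are identified, the two proofs of the axioms are
    equal by proof irrelevance, and a morphism is determined by its underlying
    map. *)
Lemma hopf_hom_eq (A B : algType K)
    (D1 D2 : A -> A ⊗ A) (e1 e2 : A -> K^o) (S1 S2 : A -> A)
    (D1' D2' : B -> B ⊗ B) (e1' e2' : B -> K^o) (S1' S2' : B -> B)
    (P1 : is_hopf (HopfData D1 e1 S1)) (P2 : is_hopf (HopfData D2 e2 S2))
    (Q1 : is_hopf (HopfData D1' e1' S1')) (Q2 : is_hopf (HopfData D2' e2' S2'))
    (f : hopf_hom (HopfAlg P1) (HopfAlg Q1)) (g : hopf_hom (HopfAlg P2) (HopfAlg Q2)) :
  D1 = D2 -> e1 = e2 -> S1 = S2 -> D1' = D2' -> e1' = e2' -> S1' = S2' ->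
  sval f = sval g ->
  existT (fun p : HopfCat K * HopfCat K => mor p.1 p.2) (HopfAlg P1, HopfAlg Q1) f =
  existT (fun p : HopfCat K * HopfCat K => mor p.1 p.2) (HopfAlg P2, HopfAlg Q2) g.
Proof.
move=> ? ? ? ? ? ?; subst.
rewrite (Prop_irrelevance P2 P1) in g *; rewrite (Prop_irrelevance Q2 Q1) in g *.
move=> fg; congr existT; apply: hopf_hom_ext => x; exact: (congr1 (@^~ x) fg).
Qed.

(** Analogue of [hopf_hom_eq] for copointed quantum heaps. *)
Lemma heap_hom_eq (A B : algType K)
    (t1 t2 : A -> A ⊗ (A^c ⊗ A)) (e1 e2 : A -> K^o)
    (t1' t2' : B -> B ⊗ (B^c ⊗ B)) (e1' e2' : B -> K^o)
    (P1 : is_copointed_heap (HeapData t1 e1)) (P2 : is_copointed_heap (HeapData t2 e2))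
    (Q1 : is_copointed_heap (HeapData t1' e1')) (Q2 : is_copointed_heap (HeapData t2' e2'))
    (f : heap_hom (CopointedHeap P1) (CopointedHeap Q1))
    (g : heap_hom (CopointedHeap P2) (CopointedHeap Q2)) :
  t1 = t2 -> e1 = e2 -> t1' = t2' -> e1' = e2' ->
  sval f = sval g ->
  existT (fun p : QHeapCat K * QHeapCat K => mor p.1 p.2)
    (CopointedHeap P1, CopointedHeap Q1) f =
  existT (fun p : QHeapCat K * QHeapCat K => mor p.1 p.2)
    (CopointedHeap P2, CopointedHeap Q2) g.
Proof.
move=> ? ? ? ?; subst.
rewrite (Prop_irrelevance P2 P1) in g *; rewrite (Prop_irrelevance Q2 Q1) in g *.
move=> fg; congr existT; apply: heap_hom_ext => x; exact: (congr1 (@^~ x) fg).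
Qed.

End FunctorEquality.

Theorem mainTheorem1 (K : fieldType) :
  exists (wF : F_well_defined K) (wchi : chi_well_defined K),
    mutually_inverse (F wF) (chi wchi).
Proof.
have wF : F_well_defined K by split; [exact: F_is_heap | exact: F_is_hom].
have wchi : chi_well_defined K by split; [exact: chi_is_hopf | exact: chi_is_hom].
exists wF, wchi; split.
  apply: functor_ext => -[[A D e S] P] [[B D' e' S'] Q] f.
  by apply: hopf_hom_eq => //; apply: funext;
    first [exact: (chi_F_comul P) | exact: (chi_F_antipode P)
         | exact: (chi_F_comul Q) | exact: (chi_F_antipode Q)].
apply: functor_ext => -[[A t e] P] [[B t' e'] Q] f.
by apply: heap_hom_eq => //; apply: funext;
  [exact: (F_chi_tau P) | exact: (F_chi_tau Q)].
Qed.
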